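(* Let $m,n\ge 1$, let $u=u(x_1,\dots,x_m)$ be an element of the free group on $\{x_1,\dots,x_m\}$ and $v=v(y_1,\dots,y_n)$ an element of the free group on $\{y_1,\dots,y_n\}$, where $x_1,\dots,x_m,y_1,\dots,y_n$ are distinct, and let $G$ be the amalgamated product $$G=\langle x_1,\dots,x_m,y_1,\dots,y_n \mid u(x_1,\dots,x_m)=v(y_1,\dots,y_n)\rangle.$$ If $u$ is a basic commutator in $\{x_1,\dots,x_m\}$ and $v$ is a basic commutator in $\{y_1,\dots,y_n\}$, then $G$ is residually torsion-free nilpotent.
   Context: Commutators: $[x,y]=x^{-1}y^{-1}xy$. A group $G$ is residually torsion-free nilpotent if for each $g\in G$, $g\ne 1$, there is a normal subgroup $N$ of $G$ with $g\notin N$ and $G/N$ torsion-free nilpotent. Basic commutators: let $S$ be a non-empty finite set and let $M$ be the free groupoid (free magma) on $S$, whose elements are the bracketed products of elements of $S$; the number of factors of $g\in M$ is its length (weight) $|g|$. A sequence $b_1,b_2,\dots$ of elements of $M$ is a basic sequence in $S$ if (1) every element of $S$ occurs in the sequence; (2) if $|b_i|<|b_j|$ then $i<j$; (3) an element $g=hl$ ($h,l\in M$) of length at least 2 occurs in the sequence if and only if $h=b_i$, $l=b_j$ with $j<i$, and either $|b_i|=1$ or $b_i=b_rb_s$ with $s\le j$. The terms of a basic sequence are called basic commutators in $S$; a basic commutator is regarded as an element of the free group on $S$ by interpreting the product $hl$ as the commutator $[h,l]$. *)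

(* Defs.v *)
From HB Require Import structures.
From mathcomp Require Import all_boot.
From mathcomp Require Import boolp classical_sets.

Set Implicit Arguments.
Unset Strict Implicit.
Unset Printing Implicit Defensive.

Local Open Scope classical_set_scope.
Local Open Scope group_scope.

Definition is_subgroup (G : groupType) (H : set G) : Prop :=
  [/\ H 1, forall x y, H x -> H y -> H (x * y) & forall x, H x -> H x^-1].

Definition is_normal (G : groupType) (N : set G) : Prop :=
  is_subgroup N /\ forall x y, N x -> N (x ^ y).

Record normal_subgroup (G : groupType) := NormalSubgroup {
  nset :> set G;
  nsetP : is_normal nset
}.

Section Quotient.
Variables (G : groupType) (N : normal_subgroup G).

Definition coset_eq : rel G := fun x y => `[< nset N (x^-1 * y) >].

Let N1 : nset N 1. Proof. by case: (nsetP N) => -[]. Qed.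
Let NM x y : nset N x -> nset N y -> nset N (x * y).
Proof. by case: (nsetP N) => -[_ h _] _; exact: h. Qed.
Let NV x : nset N x -> nset N x^-1. Proof. by case: (nsetP N) => -[_ _ h] _; exact: h. Qed.
Let NJ x y : nset N x -> nset N (x ^ y). Proof. by case: (nsetP N) => _; exact. Qed.

Lemma coset_eqP x y : reflect (nset N (x^-1 * y)) (coset_eq x y).
Proof. exact: asboolP. Qed.

Lemma coset_eq_equiv : equiv_class_of coset_eq.
Proof.
have sym x y : coset_eq x y -> coset_eq y x.
  by move=> /coset_eqP /NV; rewrite invgM invgK => h; apply/coset_eqP.
split=> [x | x y | y x z].
- by apply/coset_eqP; rewrite mulVg.
- by apply/idP/idP; exact: sym.
move=> /coset_eqP xy /coset_eqP yz; apply/coset_eqP.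
by have := NM xy yz; rewrite mulgA mulgK.
Qed.

Canonical coset_eq_equiv_rel := EquivRelPack coset_eq_equiv.

Definition quot : Type := {eq_quot coset_eq}%qT.
HB.instance Definition _ := Choice.on quot.
HB.instance Definition _ := EqQuotient.on quot.

Definition quot_proj (x : G) : quot := (\pi_quot x)%qT.

Lemma quot_projP x y : quot_proj x = quot_proj y <-> nset N (x^-1 * y).
Proof.
rewrite /quot_proj; split=> [/eqP | h].
  by rewrite eqquotE => /coset_eqP.
by apply/eqP; rewrite eqquotE; apply/coset_eqP.
Qed.

Let reprE q : quot_proj (repr q) = q. Proof. exact: reprK. Qed.

Definition quot_one : quot := quot_proj 1.
Definition quot_mul (p q : quot) : quot := quot_proj (repr p * repr q).
Definition quot_inv (p : quot) : quot := quot_proj (repr p)^-1.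

Let repr_proj x : nset N (x^-1 * repr (quot_proj x)).
Proof. by apply/quot_projP; rewrite reprE. Qed.

Let projM x y : quot_mul (quot_proj x) (quot_proj y) = quot_proj (x * y).
Proof.
apply/esym/quot_projP.
have -> : (x * y)^-1 * (repr (quot_proj x) * repr (quot_proj y)) =
    (x^-1 * repr (quot_proj x)) ^ y * (y^-1 * repr (quot_proj y)).
  by rewrite /conjg invgM !mulgA mulgK.
exact: NM (NJ _ (repr_proj x)) (repr_proj y).
Qed.

Let projV x : quot_inv (quot_proj x) = quot_proj x^-1.
Proof.
apply/quot_projP; rewrite invgK.
have -> : repr (quot_proj x) * x^-1 = (x^-1 * repr (quot_proj x)) ^ x^-1.
  by rewrite /conjg invgK !mulgA mulgV mul1g.
exact/NJ/repr_proj.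
Qed.

Let quot_mulA : associative quot_mul.
Proof.
move=> p q r; rewrite -(reprE p) -(reprE q) -(reprE r).
by rewrite !projM mulgA.
Qed.
Let quot_mul1 : left_id quot_one quot_mul.
Proof. by move=> p; rewrite -(reprE p) projM mul1g. Qed.
Let quot_1mul : right_id quot_one quot_mul.
Proof. by move=> p; rewrite -(reprE p) projM mulg1. Qed.
Let quot_mulV : left_inverse quot_one quot_inv quot_mul.
Proof. by move=> p; rewrite -(reprE p) projV projM mulVg. Qed.
Let quot_Vmul : right_inverse quot_one quot_inv quot_mul.
Proof. by move=> p; rewrite -(reprE p) projV projM mulgV. Qed.

HB.instance Definition _ :=
  isGroup.Build quot quot_mulA quot_mul1 quot_1mul quot_mulV quot_Vmul.

Lemma quot_projM : {morph quot_proj : x y / x * y}.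
Proof. by move=> x y; rewrite -projM. Qed.

End Quotient.

Lemma smallest_normal (G : groupType) (A : set G) :
  is_normal (smallest (@is_normal G) A).
Proof.
split; first split.
- by move=> M [[[h _ _] _] _].
- by move=> x y hx hy M MP; case: (MP) => -[[_ h _] _] _; exact: h (hx _ MP) (hy _ MP).
- by move=> x hx M MP; case: (MP) => -[[_ _ h] _] _; exact: h (hx _ MP).
by move=> x y hx M MP; case: (MP) => -[_ h] _; exact: h (hx _ MP).
Qed.

Definition normal_closure (G : groupType) (A : set G) : normal_subgroup G :=
  NormalSubgroup (smallest_normal A).

Definition torsion_free (G : groupType) : Prop :=
  forall (x : G) (k : nat), (0 < k)%N -> x ^+ k = 1 -> x = 1.

(* The index is shifted: [lower_central G i] is gamma_(i+1)(G).               *)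
Fixpoint lower_central (G : groupType) (i : nat) : set G :=
  if i is i'.+1 then
    smallest (@is_subgroup G)
      [set g | exists2 x, @lower_central G i' x & exists y, g = [~ x, y]]
  else setT.

Definition is_nilpotent (G : groupType) : Prop :=
  exists c, @lower_central G c = [set 1].

Definition residually_torsion_free_nilpotent (G : groupType) : Prop :=
  forall g : G, g <> 1 ->
    exists N : normal_subgroup G,
      [/\ ~ nset N g, torsion_free (quot N) & is_nilpotent (quot N)].

(* The letter [(x, false)] stands for x and [(x, true)] for x^-1. *)
Definition letter (X : Type) : Type := (X * bool)%type.

Definition letter_inv (X : Type) (a : letter X) : letter X := (a.1, ~~ a.2).

Definition reduced (X : eqType) (w : seq (letter X)) : bool :=
  sorted (fun a b => b != letter_inv a) w.

Record free_group (X : choiceType) := FreeGroup {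
  word : seq (X * bool);
  word_reduced : reduced word
}.

HB.instance Definition _ (X : choiceType) := [isSub for @word X].
HB.instance Definition _ (X : choiceType) := [Choice of free_group X by <:].

Section FreeGroup.
Variable X : choiceType.
Implicit Types (a : letter X) (v w : seq (X * bool)).

Definition push a w : seq (X * bool) :=
  if w is b :: w' then if b == letter_inv a then w' else a :: w else [:: a].

Let invK : involutive (@letter_inv X).
Proof. by case=> x b; rewrite /letter_inv /= negbK. Qed.

Lemma push_reduced a w : reduced w -> reduced (push a w).
Proof.
case: w => [|b w] //= hw; case: ifPn => [_ | ba]; first exact: path_sorted hw.
by rewrite /= ba.
Qed.

Lemma foldr_push_reduced v w : reduced w -> reduced (foldr push w v).
Proof. by elim: v => //= a v IH /IH /push_reduced. Qed.

Lemma push_cons a w : reduced (a :: w) -> push a w = a :: w.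
Proof. by case: w => //= b w /andP[/negPf-> _]. Qed.

Lemma pushK a w : reduced w -> push a (push (letter_inv a) w) = w.
Proof.
case: w => [_|b w hw] /=; first by rewrite eqxx.
rewrite invK; case: (eqVneq b a) hw => [->|_ _]; first exact: push_cons.
by rewrite /= eqxx.
Qed.

Lemma foldr_push_push a v w :
  reduced v -> reduced w -> foldr push w (push a v) = push a (foldr push w v).
Proof.
case: v => [|b v] //= hv hw; case: ifP => [/eqP-> | //].
by rewrite pushK ?foldr_push_reduced.
Qed.

Lemma foldr_push_id w : reduced w -> foldr push [::] w = w.
Proof.
elim: w => //= a w IH hw; rewrite IH ?push_cons //; exact: path_sorted hw.
Qed.

Definition free_one : free_group X := @FreeGroup X [::] isT.
Definition free_mul (u v : free_group X) : free_group X :=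
  FreeGroup (foldr_push_reduced (word u) (word_reduced v)).

Lemma inv_reduced w : reduced w -> reduced (rev (map (@letter_inv X) w)).
Proof.
rewrite /reduced rev_sorted sorted_map; apply: sub_sorted => a b /=.
by apply: contra => /eqP /(can_inj invK) ->; rewrite invK.
Qed.

Definition free_inv (u : free_group X) : free_group X :=
  FreeGroup (inv_reduced (word_reduced u)).

Let free_mulA : associative free_mul.
Proof.
move=> [u hu] [v hv] [w hw]; apply: val_inj => /=.
by elim: u hu => //= a u IH hu; rewrite foldr_push_push ?foldr_push_reduced //
  IH //; exact: path_sorted hu.
Qed.

Let free_mul1 : left_id free_one free_mul.
Proof. by move=> u; apply: val_inj. Qed.

Let free_1mul : right_id free_one free_mul.
Proof. by move=> [u hu]; apply: val_inj; exact: foldr_push_id. Qed.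

Lemma foldr_pushK w (u : seq (letter X)) : reduced w ->
  foldr push (foldr push w u) (rev (map (@letter_inv X) u)) = w.
Proof.
elim: u => //= a u IH hw; rewrite rev_cons foldr_rcons.
by rewrite -{2}(invK a) pushK ?foldr_push_reduced // IH.
Qed.

Let free_mulV : left_inverse free_one free_inv free_mul.
Proof.
move=> [u hu]; apply: val_inj => /=.
by rewrite -{1}(foldr_push_id hu) foldr_pushK.
Qed.

Let free_invK : involutive free_inv.
Proof.
by move=> u; apply: val_inj; rewrite /= map_rev revK (mapK invK).
Qed.

Let free_Vmul : right_inverse free_one free_inv free_mul.
Proof. by move=> u; rewrite -{1}(free_invK u) free_mulV. Qed.

HB.instance Definition _ := isGroup.Build (free_group X)
  free_mulA free_mul1 free_1mul free_mulV free_Vmul.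

Definition free_gen (x : X) : free_group X :=
  @FreeGroup X [:: (x, false)] isT.

(* The value w(f x)_(x in X) of the group word w in a group G.                *)
Definition word_eval (G : groupType) (f : X -> G) (w : free_group X) : G :=
  \prod_(a <- word w) (if a.2 then (f a.1)^-1 else f a.1).

Lemma word_eval_gen (G : groupType) (f : X -> G) (x : X) :
  word_eval f (free_gen x) = f x.
Proof. by rewrite /word_eval big_seq1. Qed.

Lemma word_evalM (G : groupType) (f : X -> G) :
  {morph word_eval f : u v / u * v}.
Proof.
move=> [u hu] [v hv]; rewrite /word_eval /=.
elim: u {hu} => [|[x b] u IH] /=; first by rewrite big_nil mul1g.
rewrite big_cons -mulgA -IH /=; move: (foldr push v u) => [|c w] /=.
  by rewrite big_seq1 big_nil mulg1.
case: eqP => [->|_]; last by rewrite [LHS]big_cons.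
by rewrite big_cons /=; case: b; rewrite /= ?mulKg ?mulVKg.
Qed.

End FreeGroup.

Definition presented_group (X : choiceType) (R : set (free_group X)) :
  groupType := quot (normal_closure R).

(* < x_1, ..., x_m, y_1, ..., y_n | u(x_1, ..., x_m) = v(y_1, ..., y_n) >,    *)
(* where x_i is the generator [inl i] and y_j the generator [inr j].          *)
Definition amalgam (m n : nat)
    (u : free_group 'I_m) (v : free_group 'I_n) : groupType :=
  let F : groupType := free_group ('I_m + 'I_n)%type in
  let x (i : 'I_m) : F := free_gen (inl i) in
  let y (j : 'I_n) : F := free_gen (inr j) in
  presented_group [set word_eval x u * (word_eval y v)^-1].

Inductive magma (S : Type) : Type :=
| Leaf of S
| Node of magma S & magma S.

Fixpoint weight (S : Type) (g : magma S) : nat :=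
  if g is Node h l then (weight h + weight l)%N else 1%N.

(* A basic sequence is finite when S is a singleton and infinite otherwise.   *)
(* A finite or infinite sequence b_0, b_1, ... of distinct terms is encoded   *)
(* as a function b to [option], with [b i = None] past the end. Without       *)
(* distinctness x, x, ... would be allowed and [x, x] would be basic.         *)
Definition is_sequence (T : Type) (b : nat -> option T) : Prop :=
  (forall i j, (i <= j)%N -> b i = None -> b j = None) /\
  (forall i j g, b i = Some g -> b j = Some g -> i = j).

Definition occurs (T : Type) (b : nat -> option T) (g : T) : Prop :=
  exists i, b i = Some g.

Definition basic_sequence (S : Type) (b : nat -> option (magma S)) : Prop :=
  [/\ is_sequence b,
      forall s, occurs b (Leaf s),
      forall i j g h, b i = Some g -> b j = Some h ->
        (weight g < weight h)%N -> (i < j)%N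
    & forall h l, occurs b (Node h l) <->
        exists i j, [/\ b i = Some h, b j = Some l, (j < i)%N
          & weight h = 1%N \/
            exists r s g k, [/\ b r = Some g, b s = Some k, h = Node g k
                              & (s <= j)%N]]].

Fixpoint commutator_value (S : choiceType) (g : magma S) : free_group S :=
  match g with
  | Leaf s => free_gen s
  | Node h l => [~ commutator_value h, commutator_value l]
  end.

Definition basic_commutator (S : choiceType) (w : free_group S) : Prop :=
  exists (b : nat -> option (magma S)) (g : magma S),
    [/\ basic_sequence b, occurs b g & w = commutator_value g].

(* Main.v *)
From HB Require Import structures.
Require Import Defs.
From mathcomp Require Import all_boot all_algebra.
From mathcomp Require Import boolp classical_sets.
From mathcomp Require Import zify ring.

Set Implicit Arguments.
Unset Strict Implicit.
Unset Printing Implicit Defensive.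

(* Only two properties of [u] and [v] matter: neither is trivial nor a proper *)
(* power.  For basic commutators this follows by elimination: a basic         *)
(* commutator is a free generator of a subgroup reached by finitely many      *)
(* steps, each of which passes to the kernel of a map onto an infinite cyclic *)
(* group.                                                                     *)
(* Let Z be the union of the two alphabets and P = Q<<Z>> the ring of         *)
(* noncommutative power series, in which the free group on Z embeds by the    *)
(* Magnus map x |-> 1 + x.  Put t = u - 1 and t' = v - 1 in P.  If w is a     *)
(* shortest word of t, every series is uniquely t * q + r with r free of      *)
(* words starting with w; iterating, P is a free module over Q[[t]], and      *)
(* likewise over Q[[t']].  Weighting the letters so that w and w' have the    *)
(* same weight, exchanging the prefixes w and w' matches the two bases, which *)
(* gives a weight-preserving isomorphism Xi of P that turns t into t'.        *)
(* Letting the x_i act by left multiplication and the y_j by left             *)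
(* multiplication conjugated by Xi, u and v act in the same way, so the       *)
(* amalgam acts on P by unipotent automorphisms for the weight filtration,    *)
(* and such groups have torsion-free nilpotent quotients.                     *)
(* The action is faithful: in an alternating product each factor a outside    *)
(* the amalgamated subgroup lengthens, by one block of letters of its own     *)
(* colour, the words occurring in the image of the series 1.  Otherwise a     *)
(* would map some nonzero power series in t to another one, hence commute     *)
(* with t and with u, and so be a power of u.                                 *)

Import GRing.Theory Num.Theory.
Local Open Scope classical_set_scope.
Local Open Scope group_scope.

(** * Filtrations and torsion-free nilpotent quotients *)

(** The amalgam acts on power series in such a way that g - 1 raises the weight of series for every
    element g. The automorphisms a for which a - 1 raises weights by at least n+1 form a central
    filtration with isolated terms, so their preimages are normal with torsion-free nilpotent
    quotients ([filtered_aut_residual]). Weights separate series, so it suffices that every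
    nontrivial element moves some series; the series 1 serves for all of them.

    The relation is respected because [u] and [v] act in the same way ([rho_relation]). Every
    element of the amalgam is represented by an integer power of [u] or by an alternating product
    ([normal_formP]). The former moves 1, unless trivial, because the Magnus map is injective
    ([mono_rho]); the latter moves it because each factor adds a block ([block_length_step],
    [alternating_rho]). This growth rests on the centralizer of [c s] being the cyclic group it
    generates ([no_proper_power_centralizer]), and here basic commutators enter, through
    [basic_commutator_no_proper_power]. *)

Lemma word_eval_morphism (X : choiceType) (G : groupType) (f : X -> G) :
  (word_eval f 1 = 1) * {morph word_eval f : x y / x * y}.
Proof. by split; [rewrite /word_eval big_nil | exact: word_evalM]. Qed.

HB.instance Definition _ (X : choiceType) (G : groupType) (f : X -> G) :=
  isUMagmaMorphism.Build (free_group X) G (word_eval f)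
    (word_eval_morphism f).

Lemma quot_proj_morphism (G : groupType) (N : normal_subgroup G) :
  (quot_proj N 1 = 1) * {morph quot_proj N : x y / x * y}.
Proof. by split; [ | exact: quot_projM]. Qed.

HB.instance Definition _ (G : groupType) (N : normal_subgroup G) :=
  isUMagmaMorphism.Build G (quot N) (@quot_proj G N) (quot_proj_morphism N).

Lemma quot_projK (G : groupType) (N : normal_subgroup G) (q : quot N) :
  quot_proj N (repr q) = q.
Proof. exact: reprK. Qed.

Lemma quot_proj_eq1 (G : groupType) (N : normal_subgroup G) (x : G) :
  quot_proj N x = 1 <-> nset N x.
Proof.
have -> : 1 = quot_proj N 1 by []; split=> [/esym/quot_projP | h].
  by rewrite invg1 mul1g.
by apply/esym/quot_projP; rewrite invg1 mul1g.
Qed.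

Section CentralFiltration.
Variables (G H : groupType) (phi : UMagmaMorphism.type G H).
Variable D : nat -> set H.
Hypothesis D0 : forall x, D 0 x.
Hypothesis DG : forall i, is_subgroup (D i).
Hypothesis DS : forall i, D i.+1 `<=` D i.
Hypothesis DR : forall i x y, D i x -> D i.+1 [~ x, y].
Hypothesis DX : forall i x k, (0 < k)%N -> D i (x ^+ k) -> D i x.

Lemma preimage_filtration_normal n : is_normal [set g | D n (phi g)].
Proof.
have [D1 DM DV] := DG n.
split=> [|x y /= hx]; first split=> [|x y /= hx hy|x /= hx].
- by rewrite /= gmulf1.
- by rewrite gmulfM; exact: DM.
- by rewrite gmulfV; exact: DV.
rewrite gmulfJ -(mulVKg (phi x) (phi x ^ phi y)) -commgEl.
by apply: DM => //; apply: DS; apply: DR.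
Qed.

Definition preimage_filtration n := NormalSubgroup (preimage_filtration_normal n).

Lemma preimage_filtration_torsion_free n :
  torsion_free (quot (preimage_filtration n)).
Proof.
move=> x k k0; rewrite -(quot_projK x) -gmulfXn => /quot_proj_eq1 /=.
by rewrite gmulfXn => /(DX k0) h; apply/quot_proj_eq1.
Qed.

Lemma preimage_filtration_lower_central n i :
  @lower_central (quot (preimage_filtration n)) i `<=`
  [set q | exists2 g, q = quot_proj _ g & D i (phi g)].
Proof.
elim: i => [q _|i IH] /=; first by exists (repr q); rewrite ?quot_projK.
have [D1 DM DV] := DG i.+1.
apply: smallest_sub; first split.
- by exists 1; rewrite ?gmulf1.
- move=> _ _ [g -> hg] [h -> hh]; exists (g * h); rewrite ?gmulfM //.
  exact: DM.
- by move=> _ [g -> hg]; exists g^-1; rewrite gmulfV //; exact: DV.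
move=> _ [x /IH[g -> hg] [y ->]]; exists [~ g, repr y].
  by rewrite gmulfR /= quot_projK.
by rewrite gmulfR; exact: DR.
Qed.

Lemma preimage_filtration_nilpotent n :
  is_nilpotent (quot (preimage_filtration n)).
Proof.
exists n; apply/seteqP; split=> q /=.
  by move=> /preimage_filtration_lower_central[g -> hg]; apply/quot_proj_eq1.
have h i : @lower_central (quot (preimage_filtration n)) i 1.
  by case: i => [//|i] A [[A1 _ _] _]; exact: A1.
by move=> ->; exact: h.
Qed.

End CentralFiltration.

(** [levelX] says that [V] is torsion-free modulo each level; it is the source of the
    torsion-freeness of the quotient groups. *)
Record filtration (V : zmodType) := Filtration {
  level :> nat -> set V;
  level0 : forall i, level i 0%R;
  levelD : forall i v w, level i v -> level i w -> level i (v + w)%R;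
  levelN : forall i v, level i v -> level i (- v)%R;
  levelS : forall i, level i.+1 `<=` level i;
  levelX : forall i k v, (0 < k)%N -> level i (v *+ k)%R -> level i v
}.

Section FilteredAutomorphisms.
Variables (V : zmodType) (F : filtration V).

Let F_0 := level0 F.
Let FD := @levelD V F.
Let FN := @levelN V F.
Let FS := @levelS V F.
Let FX := @levelX V F.

Definition raises n (f : V -> V) := forall i v, F i v -> F (i + n) (f v - v)%R.

(** Both the map and its inverse are required to raise levels, so that inversion merely exchanges
    the fields. *)
Record filtered_aut := FilteredAut {
  faut :> V -> V;
  faut_inv : V -> V;
  fautD : forall v w, faut (v + w)%R = (faut v + faut w)%R;
  fautK : cancel faut faut_inv;
  faut_invK : cancel faut_inv faut;
  faut_raises : raises 1 faut;
  faut_inv_raises : raises 1 faut_inv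
}.

HB.instance Definition _ := gen_eqMixin filtered_aut.
HB.instance Definition _ := gen_choiceMixin filtered_aut.

Lemma faut_inj (f g : filtered_aut) : f =1 g -> f = g.
Proof.
case: f g => [f f' fD fK f'K fr f'r] [g g' gD gK g'K gr g'r] /= /funext fg.
move: fD fK f'K fr f'r; rewrite {}fg => fD fK f'K fr f'r.
have fg : f' = g' by apply/funext => v; apply: (can_inj gK); rewrite f'K g'K.
move: fK f'K f'r; rewrite {}fg => fK f'K f'r.
by congr FilteredAut; exact: Prop_irrelevance.
Qed.

Lemma fautB (f : filtered_aut) v w : f (v - w)%R = (f v - f w)%R.
Proof. by apply: (addIr (f w)); rewrite -fautD !subrK. Qed.

Lemma faut_invD (f : filtered_aut) v w :
  faut_inv f (v + w)%R = (faut_inv f v + faut_inv f w)%R.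
Proof. by apply: (can_inj (@fautK f)); rewrite fautD !faut_invK. Qed.

Lemma filtration_leq i j : (i <= j)%N -> F j `<=` F i.
Proof. by move=> /subnK <-; elim: (j - i)%N => // k IH v /FS /IH. Qed.

Lemma filtrationB i v w : F i v -> F i w -> F i (v - w)%R.
Proof. by move=> hv /FN; exact: FD. Qed.

Lemma raises_filtration n (f : V -> V) i v : raises n f -> F i v -> F i (f v).
Proof.
move=> fr hv; rewrite -(subrK v (f v)); apply: FD => //.
by apply: (filtration_leq (leq_addr n i)); exact: fr.
Qed.

Lemma raises_comp n (f g : V -> V) :
  raises n f -> raises n g -> raises n (f \o g).
Proof.
move=> fr gr i v hv /=; rewrite -(subrK (g v) (f (g v))) -addrA.
by apply: FD; [apply/fr/(raises_filtration gr) | apply: gr].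
Qed.

Lemma raises_id n : raises n id.
Proof. by move=> i v _; rewrite subrr; exact: F_0. Qed.

Definition faut_one : filtered_aut :=
  @FilteredAut id id (fun _ _ => erefl) (fun=> erefl) (fun=> erefl)
    (raises_id 1) (raises_id 1).

Definition faut_mul (f g : filtered_aut) : filtered_aut.
Proof.
apply: (@FilteredAut (f \o g) (faut_inv g \o faut_inv f)).
- by move=> v w /=; rewrite !fautD.
- by move=> v /=; rewrite !fautK.
- by move=> v /=; rewrite !faut_invK.
- by apply: raises_comp; exact: faut_raises.
- by apply: raises_comp; exact: faut_inv_raises.
Defined.

Definition faut_opp (f : filtered_aut) : filtered_aut :=
  FilteredAut (@faut_invD f) (@faut_invK f) (@fautK f)
    (@faut_inv_raises f) (@faut_raises f).

Lemma faut_mulA : associative faut_mul.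
Proof. by move=> f g h; exact: faut_inj. Qed.
Lemma faut_mul1 : left_id faut_one faut_mul.
Proof. by move=> f; exact: faut_inj. Qed.
Lemma faut_1mul : right_id faut_one faut_mul.
Proof. by move=> f; exact: faut_inj. Qed.
Lemma faut_mulV : left_inverse faut_one faut_opp faut_mul.
Proof. by move=> f; apply: faut_inj => v /=; rewrite fautK. Qed.
Lemma faut_Vmul : right_inverse faut_one faut_opp faut_mul.
Proof. by move=> f; apply: faut_inj => v /=; rewrite faut_invK. Qed.

HB.instance Definition _ := isGroup.Build filtered_aut
  faut_mulA faut_mul1 faut_1mul faut_mulV faut_Vmul.

(** The shift makes term 0 the whole group, in step with the indexing of [lower_central]. *)
Definition faut_filtration n : set filtered_aut := [set f | raises n.+1 f].

Lemma faut_filtration_group n : is_subgroup (faut_filtration n).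
Proof.
split=> [|f g|f fr i v hv]; [exact: raises_id | exact: raises_comp |].
have hw : F i (f^-1 v) by apply: raises_filtration hv; exact: faut_inv_raises.
rewrite -[X in (_ - X)%R](@faut_invK f) -opprB; apply: FN.
exact: fr.
Qed.

Lemma faut_filtrationS n : faut_filtration n.+1 `<=` faut_filtration n.
Proof.
by move=> f fr i v /fr; apply: filtration_leq; rewrite leq_add2l.
Qed.

(** Applying g f to ([f, g] - 1) v gives the ring commutator ((f - 1)(g - 1) - (g - 1)(f - 1)) v,
    which lies n+2 levels up, and the inverse of g f preserves levels. *)
Lemma faut_filtrationR n f g :
  faut_filtration n f -> faut_filtration n.+1 [~ f, g].
Proof.
move=> fr i v hv.
set c : filtered_aut := [~ f, g]; set h : filtered_aut := g * f.
have -> : (c v - v = (h^-1)%g (h (c v - v)))%R.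
  by rewrite -[RHS]/((h^-1 * h) _) mulVg.
have -> : (h (c v - v) = (f (g v - v) - (g v - v)) - (g (f v - v) - (f v - v)))%R.
  rewrite fautB -[h (c v)]/((h * c) v) -commgC !fautB.
  rewrite -[(f * g) v]/(f (g v)) -[h v]/(g (f v)).
  rewrite -[(f _ - _ - _)%R]addrA -[(g _ - _ - _)%R]addrA -!opprD.
  rewrite [X in (_ = _ - (_ - X))%R]addrCA; set w := (f v + _)%R.
  by rewrite opprB addrA subrK.
have hh w j : F j w -> F j (h^-1 w).
  by apply: raises_filtration; exact: faut_inv_raises.
apply: hh; apply: filtrationB.
  have -> : (i + n.+2 = i + 1 + n.+1)%N by rewrite -addnA add1n.
  by apply: fr; exact: faut_raises.
have -> : (i + n.+2 = i + n.+1 + 1)%N by rewrite -addnA addn1.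
by apply: faut_raises; exact: fr.
Qed.

(** If f - 1 raises by m+1, then f^k - 1 agrees with k (f - 1) one level further up. Since levels
    are isolated, f - 1 then raises by m+2 as long as f^k - 1 does. *)
Lemma faut_filtrationX n k (f : filtered_aut) :
  (0 < k)%N -> faut_filtration n (f ^+ k) -> faut_filtration n f.
Proof.
move=> k0 hk.
suff: forall m, (m <= n)%N -> faut_filtration m f by apply.
elim=> [_|m IH mn]; first exact: faut_raises.
have {IH} fm := IH (ltnW mn) => i v hv.
have hpow j : F (i + m.+2) ((f ^+ j)%g v - v - (f v - v) *+ j)%R.
  elim: j => [|j IHj]; first by rewrite mulr0n subr0 subrr; exact: F_0.
  rewrite expgS -[(f * _) v]/(f ((f ^+ j)%g v)) mulrSr.
  set a := (f ^+ j)%g v in IHj *.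
  have -> : (f a - v - ((f v - v) *+ j + (f v - v)) =
      (a - v - (f v - v) *+ j) + (f (a - v) - (a - v)))%R.
    rewrite [RHS]addrC [RHS]addrA subrK fautB.
    rewrite [(_ *+ j + _)%R]addrC opprD [LHS]addrA; congr (_ - _)%R.
    by rewrite opprB addrA subrK.
  apply: FD => //.
  have: F (i + m.+1) (a - v)%R.
    rewrite -(subrK ((f v - v) *+ j)%R (a - v)%R); apply: FD.
      by apply: filtration_leq IHj; rewrite leq_add2l.
    elim: (j) => [|l IHl]; first by rewrite mulr0n; exact: F_0.
    by rewrite mulrS; apply: FD => //; exact: fm.
  by move=> /(@faut_raises f); rewrite -addnA addn1.
have hk' : F (i + m.+2) ((f ^+ k)%g v - v)%R.
  by apply: filtration_leq (hk i v hv); rewrite leq_add2l.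
apply: (FX k0); rewrite -[X in F _ X](subKr ((f ^+ k)%g v - v)%R).
exact: filtrationB.
Qed.


Lemma faut_filtration0 f : faut_filtration 0 f.
Proof. exact: faut_raises. Qed.

End FilteredAutomorphisms.

Lemma filtered_aut_residual (V : zmodType) (F : filtration V) (G : groupType)
    (phi : UMagmaMorphism.type G (filtered_aut F)) (g : G) n :
  ~ faut_filtration n (phi g) -> exists N : normal_subgroup G,
    [/\ ~ nset N g, torsion_free (quot N) & is_nilpotent (quot N)].
Proof.
have DG := @faut_filtration_group V F.
have DS := @faut_filtrationS V F.
have DR := @faut_filtrationR V F.
have DX := @faut_filtrationX V F.
move=> gn; exists (preimage_filtration phi DG DS DR n); split=> //.
- by apply: preimage_filtration_torsion_free => i x k; exact: DX.
- by apply: preimage_filtration_nilpotent; exact: faut_filtration0.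
Qed.

(** * Commuting elements of a free group *)

Section Cyclic.
Variable G : groupType.
Implicit Types x y z : G.

(** Membership in the cyclic group of [z], with an integer exponent written as a difference of
    natural numbers. *)
Definition in_cycle z x := exists i j, x = z ^+ i * z ^- j.

Lemma in_cycleXn z i : in_cycle z (z ^+ i).
Proof. by exists i, 0%N; rewrite invg1 mulg1. Qed.

Lemma in_cycle_id z : in_cycle z z. Proof. exact: (in_cycleXn z 1). Qed.

Lemma in_cycle1 z : in_cycle z 1. Proof. exact: (in_cycleXn z 0). Qed.

Lemma in_cycleV z x : in_cycle z x -> in_cycle z x^-1.
Proof. by move=> [i [j ->]]; exists j, i; rewrite invgM invgK. Qed.

Lemma in_cycleM z x y : in_cycle z x -> in_cycle z y -> in_cycle z (x * y).
Proof.
move=> [i [j ->]] [k [l ->]]; exists (i + k)%N, (l + j)%N.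
rewrite !expgnDr invgM -!mulgA; congr (_ * _); rewrite !mulgA; congr (_ * _).
by apply/commute_sym/commuteV/commuteX2/commute_refl.
Qed.

Lemma in_cycleX z x n : in_cycle z x -> in_cycle z (x ^+ n).
Proof.
move=> zx; elim: n => [|n IH]; first exact: in_cycle1.
by rewrite expgS; exact: in_cycleM.
Qed.

Lemma in_cycle_trans z x y : in_cycle z x -> in_cycle x y -> in_cycle z y.
Proof.
by move=> zx [i [j ->]]; apply: in_cycleM; [|apply: in_cycleV];
  exact: in_cycleX.
Qed.

Lemma in_cycle_conj z x y : in_cycle z x -> in_cycle (z ^ y) (x ^ y).
Proof.
by move=> [i [j ->]]; exists i, j; rewrite conjMg conjVg !conjXg.
Qed.

Lemma in_cycle_power z x :
  in_cycle z x -> exists2 z', in_cycle z' z & exists k, x = z' ^+ k.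
Proof.
move=> [i [j ->]]; have [ji|/ltnW ij] := leqP j i.
  by exists z; [exact: in_cycle_id | exists (i - j)%N; rewrite expgnFr].
exists z^-1; first by rewrite -{2}(invgK z); exact/in_cycleV/in_cycle_id.
by exists (j - i)%N; rewrite expVgn expgnFr // invgM invgK.
Qed.

(* With [z = 1] this also says that [c] is not trivial. *)
Definition no_proper_power (c : G) := forall z k, c = z ^+ k -> k = 1%N.

Lemma no_proper_power_cycle c z :
  no_proper_power c -> in_cycle z c -> in_cycle c z.
Proof.
move=> hc /in_cycle_power[z' z'z [k ck]].
by move: (ck); rewrite (hc _ _ ck) expg1 => ->.
Qed.

Lemma no_proper_power_neq1 c : no_proper_power c -> c <> 1.
Proof. by move=> hc c1; have := hc 1 0%N c1. Qed.

End Cyclic.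

Section FreeGroupCommutation.
Variable X : choiceType.
Implicit Types (x y z : free_group X) (v w s : seq (letter X)).

Definition word_inv v := rev (map (@letter_inv X) v).

Lemma letter_invK : involutive (@letter_inv X).
Proof. by case=> x b; rewrite /letter_inv /= negbK. Qed.

Lemma word_inj : injective (@word X). Proof. exact: val_inj. Qed.

Lemma word_invE x : word x^-1 = word_inv (word x). Proof. by []. Qed.

Lemma word_mulE x y : word (x * y) = foldr (@push X) (word y) (word x).
Proof. by []. Qed.

Lemma word_cancel v w : reduced v -> reduced w ->
  exists v1 s w1, [/\ v = v1 ++ s, w = word_inv s ++ w1 &
                      foldr (@push X) w v = v1 ++ w1].
Proof.
elim: v => [|a v IH] rv rw; first by exists [::], [::], w.
have [v1 [s [w1 [vE wE fE]]]] := IH (path_sorted rv) rw.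
rewrite /= {}fE; case: v1 vE => [|b v1] /= vE; last first.
  exists (a :: b :: v1), s, w1; split; rewrite ?vE //=.
  by move: rv; rewrite vE /= => /andP[/negPf->].
case: w1 wE => [|b w1] wE /=.
  by exists [:: a], s, [::]; rewrite vE.
have [ba|_] := eqVneq b (letter_inv a).
  exists [::], (a :: s), w1; split; rewrite ?vE //.
  by rewrite wE ba /word_inv /= rev_cons -cats1 -catA.
by exists [:: a], s, (b :: w1); rewrite vE.
Qed.

Lemma word_mul_size x y v : word y = word x ++ v -> word (x^-1 * y) = v.
Proof.
move=> yE; have rv : reduced v.
  by have := word_reduced y; rewrite yE => /cat_sorted2[].
have -> : y = x * FreeGroup rv.
  apply/word_inj; rewrite word_mulE /= yE.
  have: reduced (word x ++ v) by rewrite -yE word_reduced.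
  elim: (word x) => //= a w IH h; rewrite -IH ?push_cons //.
  exact: path_sorted h.
by rewrite mulKg.
Qed.

Lemma word_conj a v (x : free_group X) :
  word x = a :: rcons v (letter_inv a) ->
  exists2 x' : free_group X, size (word x') < size (word x) &
    forall g : free_group X, word g = [:: a] -> x = x' ^ g^-1.
Proof.
move=> xE; have rx := word_reduced x.
have rv : reduced v.
  by move: rx; rewrite xE -cats1 /= => /path_sorted/cat_sorted2[].
exists (FreeGroup rv); first by rewrite xE /= size_rcons; lia.
move=> g gE; rewrite conjgE invgK; apply: word_inj.
rewrite !word_mulE word_invE gE /= xE.
move: rx; rewrite xE => rx.
rewrite -[LHS](foldr_push_id rx) /= -cats1 foldr_cat //.
Qed.

(** Euclid's algorithm on the total length: the pair is replaced by a shorter commuting pair,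
    obtained by multiplying one element by the other or its inverse, or by conjugating both. *)
Lemma commute_in_cycle x y :
  commute x y -> exists z, in_cycle z x /\ in_cycle z y.
Proof.
have [n] := ubnP (size (word x) + size (word y)).
elim: n x y => // n IH x y; rewrite ltnS => hn.
wlog xy : x y hn / size (word x) <= size (word y).
  move=> hw cxy; have [xy|/ltnW yx] := leqP (size (word x)) (size (word y)).
    exact: hw.
  have hn' : size (word y) + size (word x) < n.+1 by rewrite addnC.
  by have [z [zy zx]] := hw y x hn' yx (commute_sym cxy); exists z.
have [x0 _|x0] := posnP (size (word x)).
  exists y; split; last exact: in_cycle_id.
  suff -> : x = 1 by exact: in_cycle1.
  by apply: word_inj; apply: size0nil.
move=> cxy; have := congr1 (@word X) cxy; rewrite !word_mulE.
have [x1 [s [y1 [xE yE ->]]]] := word_cancel (word_reduced x) (word_reduced y).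
have [y2 [r [x2 [yE' xE' ->]]]] := word_cancel (word_reduced y) (word_reduced x).
move=> E.
have szI w : size (word_inv w) = size w by rewrite size_rev size_map.
have sx : size (word x) = (size x1 + size s)%N by rewrite xE size_cat.
have sy : size (word y) = (size s + size y1)%N by rewrite yE size_cat szI.
have sx' : size (word x) = (size r + size x2)%N by rewrite xE' size_cat szI.
have sy' : size (word y) = (size y2 + size r)%N by rewrite yE' size_cat.
have sE : (size x1 + size y1 = size y2 + size x2)%N.
  by have := congr1 size E; rewrite !size_cat.
(* Without cancellation x y and y x agree as words, so the shorter x is a prefix of y and can be
   removed from it. *)
have [s0|s0] := posnP (size s).
  have r0 : size r = 0%N by lia.
  move/size0nil: s0 => ?; move/size0nil: r0 => ?; subst s r.
  rewrite /word_inv /= ?cats0 in xE yE xE' yE'; subst x1 y1 x2 y2.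
  have yx : word y = word x ++ drop (size (word x)) (word y).
    have := congr1 (take (size (word x))) E.
    rewrite take_size_cat // takel_cat // => {1}->.
    by rewrite cat_take_drop.
  have yx' := word_mul_size yx.
  have [||z [zx zy]] := IH x (x^-1 * y).
  - by rewrite yx' size_drop; lia.
  - by apply: commuteM => //; exact/commuteV/commute_refl.
  by exists z; split=> //; rewrite -(mulVKg x y); exact: in_cycleM.
(* Here x cancels entirely against y, so x y is shorter than y. *)
have [x10|x10] := posnP (size x1).
  move/size0nil: x10 => ?; subst x1; rewrite /= in xE; subst s.
  have yx' : word (x * y) = y1.
    by rewrite -{1}(invgK x); apply: word_mul_size; rewrite yE.
  have [||z [zx zy]] := IH x (x * y).
  - have e : @size (letter X) (word x) = @size (X * bool) (word x) by [].
    have e' : size (word (x * y)) = size y1 by rewrite yx'.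
    by rewrite e'; lia.
  - by apply: commuteM => //; exact: commute_refl.
  by exists z; split=> //; rewrite -(mulKg x y); apply: in_cycleM => //; exact: in_cycleV.
have szw z : @size (letter X) (word z) = @size (X * bool) (word z) by [].
(* Cancellation is partial in both products. Comparing first and last letters shows that x and y
   both begin with a letter [a] and end with its inverse, so conjugation by [a] shortens both. *)
have y20 : 0 < size y2 by have := szw x; have := szw y; lia.
have x20 : 0 < size x2 by have := szw x; have := szw y; lia.
have {s0} s0 : s <> [::] by case: (s) s0.
case: x1 x10 xE sx E sE => // a x1 _ xE sx; case: y2 y20 yE' sy' => // b y2 _ yE' sy'.
move=> [ab E] _; subst b.
case: (lastP s) s0 xE yE sx sy => // {}s e _ xE yE sx sy.
have ea : e = letter_inv a.
  have: letter_inv e :: word_inv s ++ y1 = a :: y2 ++ r.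
    by rewrite -[RHS]yE' yE /word_inv map_rcons rev_rcons.
  by case=> <- _; rewrite letter_invK.
case: (lastP y1) sy E yE => [|{}y1 f] sy E yE.
  by rewrite size_rcons in sx sy; have := szw x; have := szw y; rewrite /= in sx sy; lia.
have fe : f = e.
  have := congr1 (last e) E; rewrite last_cat last_rcons.
  have := congr1 (last e) xE; rewrite xE' !last_cat last_rcons /=.
  by case: (x2) x20 => // c x2' _ <-.
have xw : word x = a :: rcons (x1 ++ s) (letter_inv a).
  by rewrite xE -ea rcons_cat.
have yw : word y = a :: rcons (word_inv s ++ y1) (letter_inv a).
  by rewrite yE fe -ea /word_inv map_rcons rev_rcons ea letter_invK /= rcons_cat.
have [x' x'x xJ] := word_conj xw; have [y' y'y yJ] := word_conj yw.
pose g := @FreeGroup X [:: a] isT.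
have {}xJ := xJ g erefl; have {}yJ := yJ g erefl.
have [||z [zx zy]] := IH x' y'.
- by lia.
- apply: (@conjg_inj _ g^-1); rewrite !conjMg -xJ -yJ; exact: cxy.
by exists (z ^ g^-1); rewrite xJ yJ; split; exact: in_cycle_conj.
Qed.

Lemma no_proper_power_centralizer c x :
  no_proper_power c -> commute c x -> in_cycle c x.
Proof.
move=> hc /commute_in_cycle[z [zc zx]].
exact: in_cycle_trans (no_proper_power_cycle hc zc) zx.
Qed.

End FreeGroupCommutation.

(** * Basic commutators are not proper powers *)

Section WreathProduct.
Variable H : groupType.

(** The unrestricted wreath product of [H] by the integers. On elements with [top] zero the product
    is pointwise, so that each coordinate is a homomorphism there. *)
Record wreath := Wreath { base : int -> H; top : int }.

HB.instance Definition _ := gen_eqMixin wreath.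
HB.instance Definition _ := gen_choiceMixin wreath.

Lemma wreath_ext (x y : wreath) : base x =1 base y -> top x = top y -> x = y.
Proof. by case: x y => [f i] [g j] /= /funext-> ->. Qed.

Definition wreath_one := Wreath (fun=> 1) 0%R.
Definition wreath_mul x y :=
  Wreath (fun n => base x n * base y (n - top x)%R) (top x + top y)%R.
Definition wreath_inv x :=
  Wreath (fun n => (base x (n + top x)%R)^-1) (- top x)%R.

Lemma wreath_mulA : associative wreath_mul.
Proof.
move=> x y z; apply: wreath_ext => /= [n|]; last by rewrite addrA.
by rewrite mulgA opprD addrA.
Qed.
Lemma wreath_mul1 : left_id wreath_one wreath_mul.
Proof.
by move=> x; apply: wreath_ext => /= [n|]; rewrite ?mul1g ?subr0 ?add0r.
Qed.
Lemma wreath_1mul : right_id wreath_one wreath_mul.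
Proof. by move=> x; apply: wreath_ext => /= [n|]; rewrite ?mulg1 ?addr0. Qed.
Lemma wreath_mulV : left_inverse wreath_one wreath_inv wreath_mul.
Proof.
move=> x; apply: wreath_ext => /= [n|]; last by rewrite addNr.
by rewrite opprK mulVg.
Qed.
Lemma wreath_Vmul : right_inverse wreath_one wreath_inv wreath_mul.
Proof.
move=> x; apply: wreath_ext => /= [n|]; last by rewrite subrr.
by rewrite subrK mulgV.
Qed.

HB.instance Definition _ := isGroup.Build wreath
  wreath_mulA wreath_mul1 wreath_1mul wreath_mulV wreath_Vmul.

Lemma top_expg (x : wreath) k : top (x ^+ k) = (top x *+ k)%R.
Proof.
elim: k => [//|k IH]; rewrite expgS -[LHS]/(top x + top (x ^+ k)%g)%R IH.
by rewrite mulrS.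
Qed.

Lemma base_expg (x : wreath) k n :
  top x = 0%R -> base (x ^+ k) n = base x n ^+ k.
Proof.
move=> x0; elim: k => [//|k IH]; rewrite !expgS.
by rewrite -[LHS]/(base x n * base (x ^+ k) (n - top x)%R) x0 subr0 IH.
Qed.

Definition shift := Wreath (fun=> 1) 1%R.

Lemma top_commg (x y : wreath) : top [~ x, y] = 0%R.
Proof.
rewrite -[LHS]/(- top x + (- top y + (top x + top y)))%R.
by rewrite [(top x + _)%R]addrC addKr addNr.
Qed.

Lemma base_commg (x y : wreath) n : top x = 0%R -> top y = 0%R ->
  base [~ x, y] n = [~ base x n, base y n].
Proof.
by move=> x0 y0; rewrite !commgEl !conjgE /= x0 y0 !(oppr0, addr0).
Qed.

Lemma base_commg_shift (x : wreath) n : top x = 0%R ->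
  base [~ x, shift] n = (base x n)^-1 * base x (n + 1)%R.
Proof.
move=> x0; rewrite !commgEl !conjgE /= x0 !(oppr0, addr0, opprK).
by rewrite invg1 mul1g mulg1.
Qed.

End WreathProduct.

(** The total exponent, read off as [top], equals 1 on a generator and is a multiple of k on a k-th
    power. *)
Lemma no_proper_power_gen (X : choiceType) (x : X) :
  no_proper_power (free_gen x).
Proof.
move=> z k /(congr1 (word_eval (fun=> shift (free_group X)))).
rewrite word_eval_gen gmulfXn => /(congr1 (@top _)); rewrite top_expg /=.
rewrite -mulr_natr natz => /(congr1 absz); rewrite abszM => /esym/eqP.
by rewrite muln_eq1 => /andP[_ /eqP].
Qed.

Lemma no_proper_power_morph (G H : groupType) (f : UMagmaMorphism.type G H) c :
  no_proper_power (f c) -> no_proper_power c.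
Proof. by move=> h z k ck; apply: (h (f z)); rewrite ck gmulfXn. Qed.

HB.instance Definition _ (S : Type) := gen_eqMixin (magma S).
HB.instance Definition _ (S : Type) := gen_choiceMixin (magma S).

Lemma weight_gt0 (S : Type) (g : magma S) : 0 < weight g.
Proof. by elim: g => //= h hp l _; rewrite addn_gt0 hp. Qed.

(** * Elimination of basic commutators one at a time *)

Section Elimination.
Variables (S : choiceType) (b : nat -> option (magma S)).
Hypothesis bP : basic_sequence b.
Implicit Types (i j k : nat) (g h l : magma S).

Lemma basic_index_inj i j g : b i = Some g -> b j = Some g -> i = j.
Proof. by case: bP => -[_ inj] _ _ _; exact: inj. Qed.

Lemma basic_weight_lt i j g h :
  b i = Some g -> b j = Some h -> weight g < weight h -> i < j.
Proof. by case: bP => _ _ lt _; exact: lt. Qed.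

Lemma basic_node j h l : b j = Some (Node h l) ->
  exists i k, [/\ b i = Some h, b k = Some l, k < i &
    forall h1 h2, h = Node h1 h2 -> exists2 s, s <= k & b s = Some h2].
Proof.
case: bP => _ _ _ /(_ h l)[hl _] jhl.
have [|i [k [ih kl ki hh]]] := hl; first by exists j.
exists i, k; split=> // h1 h2 hE; case: hh => [|[r [s [h1' [h2' [_ sh2 hE' sk]]]]]].
  by rewrite hE /=; have := weight_gt0 h1; have := weight_gt0 h2; lia.
by move: hE'; rewrite hE => -[_ ->]; exists s.
Qed.

(* After elimination of the first [i] basic commutators, the remaining ones   *)
(* are commutators in the letters [g] with [free_letter i g].                 *)
Definition free_letter i g : bool := `[< (exists2 j, i <= j & b j = Some g) /\
  forall h l, g = Node h l -> exists2 k, k < i & b k = Some l >].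

(** The default at a leaf that is not a letter is never reached from a term of index at least [i]:
    there a leaf is a letter, and both factors of a node that is not a letter again have index at
    least [i]. *)
Fixpoint eliminated_value i g : free_group (magma S) :=
  if free_letter i g then free_gen g else
  match g with
  | Leaf _ => free_gen g
  | Node h l => [~ eliminated_value i h, eliminated_value i l]
  end.

Lemma eliminated_value_letter i g :
  free_letter i g -> eliminated_value i g = free_gen g.
Proof. by case: g => [s|h l] /= ->. Qed.

Lemma eliminated_value_node i h l : ~~ free_letter i (Node h l) ->
  eliminated_value i (Node h l) =
  [~ eliminated_value i h, eliminated_value i l].
Proof. by move=> /= /negPf ->. Qed.

Lemma free_letter_self i g : b i = Some g -> free_letter i g.
Proof.
move=> ig; apply/asboolP; split=> [|h l gE]; first by exists i.
move: ig; rewrite gE => ihl.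
have [_ [k [_ kl _ _]]] := basic_node ihl; exists k => //.
by apply: basic_weight_lt kl ihl _; rewrite /= -[X in X < _]add0n ltn_add2r weight_gt0.
Qed.

Section Step.
Variables (i : nat) (x : magma S).
Hypothesis ix : b i = Some x.

Definition twist : free_group (magma S) -> free_group (magma S) :=
  word_eval (fun g => free_gen g * free_gen (Node g x)).
HB.instance Definition _ := UMagmaMorphism.on twist.

Lemma iter_twistM n : {morph iter n twist : y z / y * z}.
Proof. by elim: n => // n IH y z; rewrite !iterS IH gmulfM. Qed.

Lemma iter_twistV n : {morph iter n twist : y / y^-1}.
Proof. by elim: n => // n IH y; rewrite !iterS IH gmulfV. Qed.

(* Conjugation by [x] maps [g] to [g * [~ g, x]]; on the new letters this is  *)
(* the substitution [twist], which is not surjective, so its iterates are     *)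
(* recorded in a wreath product instead of a semidirect product.              *)
Definition elimination : free_group (magma S) -> wreath (free_group (magma S)) :=
  word_eval (fun g => if g == x then shift _ else
    Wreath (fun n => if n is Posz n' then iter n' twist (free_gen g) else 1) 0%R).
HB.instance Definition _ := UMagmaMorphism.on elimination.

(** Induction on [g], according to the index of its right factor. Below [i], [g] is a letter before
    and after the step; above [i], the commutator is taken coordinatewise. At [i], g = [h, x], and
    commutation with the shift gives the n-th coordinate h_n^-1 h_(n+1), which is the n-th twist of
    the new letter [Node h x]. *)
Lemma elimination_value j g : i < j -> b j = Some g ->
  top (elimination (eliminated_value i g)) = 0%R /\
  forall n, base (elimination (eliminated_value i g)) (Posz n) =
    iter n twist (eliminated_value i.+1 g).
Proof.
have letter h k : i < k -> b k = Some h -> free_letter i h ->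
    free_letter i.+1 h -> 
    top (elimination (eliminated_value i h)) = 0%R /\
    forall n, base (elimination (eliminated_value i h)) (Posz n) =
      iter n twist (eliminated_value i.+1 h).
  move=> ik kh hi hi1; rewrite !eliminated_value_letter // /elimination.
  rewrite word_eval_gen; case: eqP => // hx; move: ik.
  by rewrite (basic_index_inj (i := k) (j := i) kh) ?ltnn // hx.
elim: g j => [s|h IHh l IHl] j ij jg.
  by apply: (letter _ _ ij jg); apply/asboolP; split=> //; exists j => //; exact: ltnW.
have [p [k [ph kl kp hh]]] := basic_node jg.
have [ki|ik|ki] := ltngtP k i.
- apply: (letter _ _ ij jg); apply/asboolP; split=> [|_ _ [_ <-]].
  + by exists j => //; exact: ltnW.
  + by exists k.
  + by exists j.
  + by exists k => //; exact: ltnW.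
- have hl m : m <= k -> ~~ free_letter m (Node h l).
    move=> mk; apply/asboolPn => -[_ /(_ _ _ erefl)[k' k'm k'l]].
    by move: k'm; rewrite (basic_index_inj k'l kl) ltnNge mk.
  have [th bh] := IHh _ (ltn_trans ik kp) ph; have [tl bl] := IHl _ ik kl.
  rewrite !eliminated_value_node ?hl //; last exact: ltnW.
  rewrite gmulfR top_commg; split=> // n.
  rewrite base_commg // bh bl !commgEl !conjgE.
  by rewrite !(iter_twistM, iter_twistV).
subst k; have lx : l = x by move: kl; rewrite ix => -[].
subst l.
have [th bh] := IHh _ kp ph.
rewrite eliminated_value_node; last first.
  apply/asboolPn => -[_ /(_ _ _ erefl)[k' k'm k'l]].
  by move: k'm; rewrite (basic_index_inj k'l kl) ltnn.
rewrite gmulfR top_commg; split=> // n.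
rewrite (eliminated_value_letter (free_letter_self kl)).
have ex : elimination (free_gen x) = shift _.
  by rewrite [LHS]word_eval_gen eqxx.
rewrite [X in base [~ _, X]]ex base_commg_shift //.
rewrite -[(Posz n + 1)%R]/(Posz (n + 1)) addn1 !bh.
rewrite eliminated_value_letter; last first.
  apply/asboolP; split=> [|h1 h2 hE]; first by exists p.
  by have [s si sh2] := hh _ _ hE; exists s.
rewrite eliminated_value_letter; last first.
  apply/asboolP; split=> [|_ _ [_ <-]]; first by exists j.
  by exists i.
rewrite iterSr; have -> : twist (free_gen h) = free_gen h * free_gen (Node h x).
  by rewrite [LHS]word_eval_gen.
rewrite iter_twistM.
by rewrite mulKg.
Qed.

Lemma no_proper_power_elimination j g : i < j -> b j = Some g ->
  no_proper_power (eliminated_value i.+1 g) ->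
  no_proper_power (eliminated_value i g).
Proof.
move=> ij jg hg z k zk; have [tg bg] := elimination_value ij jg.
have tz : (top (elimination z) *+ k)%R = 0%R.
  by rewrite -top_expg -gmulfXn -zk.
(* For k = 0 the value is trivial, hence so is its coordinate 0; otherwise [z] has [top] zero and
   powers can be read in coordinate 0. *)
case: k zk tz => [zk _|k zk /eqP].
  by apply: (hg 1); rewrite -[LHS](bg 0%N) zk gmulf1.
rewrite mulrn_eq0 /= => /eqP tz.
by apply: (hg (base (elimination z) 0%R)); rewrite -base_expg // -gmulfXn -zk (bg 0%N).
Qed.

End Step.

(** Descending induction from stage [j], at which [g] is itself a free generator. *)
Lemma no_proper_power_eliminated j g i : i <= j -> b j = Some g ->
  no_proper_power (eliminated_value i g).
Proof.
move=> ij jg; rewrite -(subKn ij); elim: (j - i)%N => [|k IH].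
  rewrite subn0 eliminated_value_letter; first exact: no_proper_power_gen.
  exact: free_letter_self.
have [jk|kj] := leqP j k.
  by move: IH; have [-> ->] : (j - k = 0 /\ j - k.+1 = 0)%N by lia.
have hk : (j - k = (j - k.+1).+1)%N by lia.
have [x ix] : exists x, b (j - k.+1) = Some x.
  case E : (b _) => [x|]; first by exists x.
  by case: bP => -[/(_ _ j (leq_subr _ _) E)]; rewrite jg.
by apply: (no_proper_power_elimination ix) jg _; [lia | rewrite -hk].
Qed.

Lemma word_eval_commutator_value g :
  word_eval (fun s => free_gen (Leaf s)) (commutator_value g) =
  eliminated_value 0 g.
Proof.
elim: g => [s|h IHh l IHl] /=; first by rewrite word_eval_gen if_same.
rewrite ifF; last by apply/asboolPn => -[_ /(_ _ _ erefl)[]].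
by rewrite gmulfR /= IHh IHl.
Qed.

End Elimination.

Lemma basic_commutator_no_proper_power (S : choiceType) (u : free_group S) :
  basic_commutator u -> no_proper_power u.
Proof.
move=> [b [g [bP [j jg] ->]]].
apply: (no_proper_power_morph (f := word_eval (fun s => free_gen (Leaf s)))).
by rewrite /= (word_eval_commutator_value b); exact: no_proper_power_eliminated jg.
Qed.

Local Close Scope group_scope.
Local Open Scope ring_scope.

(** * Noncommutative power series *)

Definition series (Z : Type) : Type := seq Z -> rat.

HB.instance Definition _ (Z : Type) := gen_eqMixin (series Z).
HB.instance Definition _ (Z : Type) := gen_choiceMixin (series Z).

Section Series.
Variable Z : Type.
Implicit Types (f g h : series Z) (v w : seq Z) (z : Z) (c : rat).

Lemma series_ext f g : f =1 g -> f = g. Proof. exact: funext. Qed.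

Definition scalar c : series Z := fun w => if w is [::] then c else 0.

Definition series_add f g : series Z := fun w => f w + g w.
Definition series_opp f : series Z := fun w => - f w.

Definition lquot v f : series Z := fun w => f (v ++ w).

(** The sum over all factorizations of [w]: the first term has the empty left factor, the recursive
    call collects those whose left factor begins with [z]. *)
Fixpoint series_mul f g w : rat :=
  f [::] * g w + (if w is z :: w' then series_mul (lquot [:: z] f) g w' else 0).

Lemma series_addA : associative series_add.
Proof. by move=> f g h; apply: series_ext => w; rewrite /series_add addrA. Qed.
Lemma series_addC : commutative series_add.
Proof. by move=> f g; apply: series_ext => w; rewrite /series_add addrC. Qed.
Lemma series_add0 : left_id (scalar 0) series_add.
Proof. by move=> f; apply: series_ext => -[|z w]; rewrite /series_add add0r. Qed.
Lemma series_addN : left_inverse (scalar 0) series_opp series_add.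
Proof.
by move=> f; apply: series_ext => -[|z w]; rewrite /series_add addNr.
Qed.

HB.instance Definition _ := GRing.isZmodule.Build (series Z)
  series_addA series_addC series_add0 series_addN.

Lemma coefD f g w : (f + g) w = f w + g w. Proof. by []. Qed.
Lemma coefN f w : (- f) w = - f w. Proof. by []. Qed.
Lemma coef0 w : (0 : series Z) w = 0. Proof. by case: w. Qed.
Lemma coefB f g w : (f - g) w = f w - g w. Proof. by []. Qed.
Lemma coefMn f n w : (f *+ n) w = f w *+ n.
Proof. by elim: n => [|n IH]; rewrite ?mulr0n ?coef0 // !mulrS coefD IH. Qed.
Lemma coef_sum n (F : nat -> series Z) w :
  (\sum_(k < n) F k) w = \sum_(k < n) F k w.
Proof.
by elim: n => [|n IH]; rewrite ?big_ord0 ?coef0 // !big_ord_recr /= -IH.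
Qed.

Lemma series_mul_cons f g z w : series_mul f g (z :: w) =
  f [::] * g (z :: w) + series_mul (lquot [:: z] f) g w.
Proof. by []. Qed.

Lemma series_mulDl f g h w :
  series_mul (f + g) h w = series_mul f h w + series_mul g h w.
Proof.
elim: w f g => [|z w IH] f g /=; first by rewrite coefD mulrDl !addr0.
rewrite coefD mulrDl -[lquot [:: z] _]/(lquot [:: z] f + lquot [:: z] g) IH.
by rewrite addrACA.
Qed.

Lemma series_mulDr f g h w :
  series_mul f (g + h) w = series_mul f g w + series_mul f h w.
Proof.
elim: w f => [|z w IH] f /=; first by rewrite coefD mulrDr !addr0.
by rewrite coefD mulrDr IH addrACA.
Qed.

Lemma series_mul_scalar c f w : series_mul (scalar c) f w = c * f w.
Proof.
elim: w c f => [|z w IH] c f /=; first by rewrite addr0.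
have -> : lquot [:: z] (scalar c) = scalar 0 by apply: series_ext => -[].
by rewrite IH mul0r addr0.
Qed.

Lemma series_mul_scaler c f w : series_mul f (scalar c) w = f w * c.
Proof.
elim: w f => [|z w IH] f /=; first by rewrite addr0.
by rewrite IH mulr0 add0r.
Qed.

Lemma series_mulA f g h w :
  series_mul f (series_mul g h) w = series_mul (series_mul f g) h w.
Proof.
elim: w f g => [|z w IH] f g; first by rewrite /= !addr0 mulrA.
rewrite series_mul_cons IH [RHS]series_mul_cons.
have -> : lquot [:: z] (series_mul f g) = 
    (series_mul (scalar (f [::])) (lquot [:: z] g) : series Z) +
    (series_mul (lquot [:: z] f) g : series Z).
  by apply: series_ext => v; rewrite coefD series_mul_scalar.
rewrite series_mulDl -!IH series_mul_scalar addrA; congr (_ + _).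
by rewrite series_mul_cons mulrDr mulrA /= addr0.
Qed.

Lemma series_mulrA : associative (series_mul : series Z -> series Z -> series Z).
Proof. by move=> f g h; apply: series_ext => w; exact: series_mulA. Qed.
Lemma series_mul1r : left_id (scalar 1) (series_mul : series Z -> series Z -> series Z).
Proof. by move=> f; apply: series_ext => w; rewrite series_mul_scalar mul1r. Qed.
Lemma series_mulr1 : right_id (scalar 1) (series_mul : series Z -> series Z -> series Z).
Proof. by move=> f; apply: series_ext => w; rewrite series_mul_scaler mulr1. Qed.
Lemma series_mulrDl :
  left_distributive (series_mul : series Z -> series Z -> series Z) +%R.
Proof. by move=> f g h; apply: series_ext => w; exact: series_mulDl. Qed.
Lemma series_mulrDr :
  right_distributive (series_mul : series Z -> series Z -> series Z) +%R.
Proof. by move=> f g h; apply: series_ext => w; exact: series_mulDr. Qed.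

HB.instance Definition _ := GRing.Zmodule_isPzRing.Build (series Z)
  series_mulrA series_mul1r series_mulr1 series_mulrDl series_mulrDr.

Lemma coef1 w : (1 : series Z) w = if w is [::] then 1 else 0.
Proof. by []. Qed.
Lemma coefM_nil f g : (f * g) [::] = f [::] * g [::].
Proof. by rewrite -[LHS]/(_ + 0) addr0. Qed.
Lemma coefM_cons f g z w :
  (f * g) (z :: w) = f [::] * g (z :: w) + (lquot [:: z] f * g) w.
Proof. by []. Qed.
Lemma coef_scalarM c f w : (scalar c * f) w = c * f w.
Proof. exact: series_mul_scalar. Qed.
Lemma coefM_scalar c f w : (f * scalar c) w = f w * c.
Proof. exact: series_mul_scaler. Qed.
Lemma scalar_comm c f : scalar c * f = f * scalar c.
Proof.
by apply: series_ext => w; rewrite coef_scalarM coefM_scalar mulrC.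
Qed.
Lemma scalarM c d : scalar c * scalar d = scalar (c * d).
Proof. by apply: series_ext => -[|z w]; rewrite coef_scalarM //= mulr0. Qed.

Lemma series_neq0 f : f <> 0 -> exists w, f w != 0.
Proof.
move=> f0; apply: contrapT => h; apply: f0; apply: series_ext => w.
by rewrite coef0; apply/eqP; apply: contrapT => /negP fw; apply: h; exists w.
Qed.

Lemma coefM_neq0 f g w : (f * g) w != 0 ->
  exists v1 v2, [/\ w = v1 ++ v2, f v1 != 0 & g v2 != 0].
Proof.
elim: w f => [|z w IH] f.
  rewrite coefM_nil mulf_eq0 => /norP[f0 g0].
  by exists [::], [::].
rewrite coefM_cons; have [-> |fg] := eqVneq (f [::] * g (z :: w)) 0.
  rewrite add0r => /IH[v1 [v2 [-> h1 h2]]].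
  by exists (z :: v1), v2.
by move: fg; rewrite mulf_eq0 => /norP[f0 g0] _; exists [::], (z :: w).
Qed.

Lemma lquotD v f g : lquot v (f + g) = lquot v f + lquot v g.
Proof. by []. Qed.
Lemma lquotB v f g : lquot v (f - g) = lquot v f - lquot v g.
Proof. by []. Qed.

(** In a factorization of [v ++ w] that contributes, the left factor is at least as long as [v] and
    therefore begins with it. *)
Lemma lquotM_low v f g : (forall w, (size w < size v)%N -> f w = 0) ->
  lquot v (f * g) = lquot v f * g.
Proof.
elim: v f => [|z v IH] f f0 //.
have -> : lquot (z :: v) (f * g) = lquot v (lquot [:: z] (f * g)) by [].
have -> : lquot [:: z] (f * g) = lquot [:: z] f * g.
  by apply: series_ext => w; rewrite {1}/lquot /= coefM_cons f0 // mul0r add0r.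
by rewrite IH // => w wv; exact: f0.
Qed.

Lemma coefM_low f g w : (forall v, (size v < size w)%N -> g v = 0) ->
  (f * g) w = f [::] * g w.
Proof.
case: w => [|z w] g0; first exact: coefM_nil.
rewrite coefM_cons; have [->|] := eqVneq ((lquot [:: z] f * g) w) 0.
  by rewrite addr0.
move=> /coefM_neq0[v1 [v2 [wE _]]]; rewrite g0 ?eqxx //.
by rewrite wE /= size_cat; lia.
Qed.

Lemma lowest_word f : f <> 0 ->
  exists2 w, f w != 0 & forall v, (size v < size w)%N -> f v = 0.
Proof.
move=> /series_neq0[w0 fw0].
pose P n := `[< exists2 w, size w = n & f w != 0 >].
have exP : exists n, P n by exists (size w0); apply/asboolP; exists w0.
case: (ex_minnP exP) => n /asboolP[w wn fw] nmin; exists w => // v vw.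
apply/eqP; apply: contraLR vw => fv; rewrite -leqNgt wn; apply: nmin.
by apply/asboolP; exists v.
Qed.

(** For shortest words v of f and w of g, the coefficient of the product at [v ++ w] is f v * g
    w. *)
Lemma series_mulf_eq0 f g : f * g = 0 -> f = 0 \/ g = 0.
Proof.
move=> fg; have [->|f0] := pselect (f = 0); first by left.
have [->|g0] := pselect (g = 0); first by right.
have [v fv fl] := lowest_word f0; have [w gw gl] := lowest_word g0.
have : lquot v (f * g) w = 0 by rewrite fg /lquot coef0.
rewrite lquotM_low // coefM_low // /lquot cats0 => /eqP.
by rewrite mulf_eq0 (negPf fv) (negPf gw).
Qed.

Lemma series_mulfI f g h : f <> 0 -> f * g = f * h -> g = h.
Proof.
move=> f0 /eqP; rewrite -subr_eq0 -mulrBr => /eqP /series_mulf_eq0[//|/eqP].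
by rewrite subr_eq0 => /eqP.
Qed.

End Series.

(** * The weight filtration and infinite sums *)

Section Filtration.
Variables (Z : eqType) (wt : Z -> nat).
Hypothesis wt0 : forall z, (0 < wt z)%N.
Implicit Types (f g h : series Z) (v w : seq Z) (c : rat) (i j k n : nat).

Definition word_weight w := sumn (map wt w).

Lemma word_weight_cat v w :
  word_weight (v ++ w) = (word_weight v + word_weight w)%N.
Proof. by rewrite /word_weight map_cat sumn_cat. Qed.

Lemma word_weight_gt0 w : w <> [::] -> (0 < word_weight w)%N.
Proof.
by case: w => //= z w _; rewrite /word_weight /= addn_gt0 wt0.
Qed.

Definition fil i : set (series Z) :=
  [set f | forall w, (word_weight w < i)%N -> f w = 0].

Lemma filP i f :
  fil i f <-> forall w, f w != 0 -> (i <= word_weight w)%N.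
Proof.
split=> fi w; first by apply: contraNT; rewrite -ltnNge => /fi->.
by move=> wi; apply/eqP; apply: contraTT wi => /fi; rewrite -leqNgt.
Qed.

Lemma fil_zero i : fil i 0. Proof. by move=> w _; exact: coef0. Qed.
Lemma filD i f g : fil i f -> fil i g -> fil i (f + g).
Proof. by move=> fi gi w wi; rewrite coefD fi // gi // addr0. Qed.
Lemma filN i f : fil i f -> fil i (- f).
Proof. by move=> fi w wi; rewrite coefN fi // oppr0. Qed.
Lemma filB i f g : fil i f -> fil i g -> fil i (f - g).
Proof. by move=> fi /filN; exact: filD. Qed.
Lemma fil_leq i j f : (i <= j)%N -> fil j f -> fil i f.
Proof. by move=> ij fj w wi; apply: fj; exact: leq_trans wi ij. Qed.
Lemma filM i j f g : fil i f -> fil j g -> fil (i + j) (f * g).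
Proof.
move=> /filP fi /filP gj; apply/filP => w /coefM_neq0[v1 [v2 [-> /fi h1 /gj h2]]].
by rewrite word_weight_cat leq_add.
Qed.
Lemma filX i f k : fil i f -> fil (k * i) (f ^+ k).
Proof.
move=> fi; elim: k => [//|k IH]; rewrite exprS mulSn; exact: filM.
Qed.
Lemma fil_eq0 f : (forall i, fil i f) -> f = 0.
Proof.
by move=> fi; apply: series_ext => w; rewrite coef0; exact: (fi (word_weight w).+1).
Qed.
Lemma fil_isolated i k f : (0 < k)%N -> fil i (f *+ k) -> fil i f.
Proof.
move=> k0 fk w /fk /eqP; rewrite coefMn mulrn_eq0 => /orP[/eqP k0'|/eqP //].
by rewrite k0' in k0.
Qed.

(** If the k-th term has weight at least k, as [infinite_sum_approx] assumes, the omitted terms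
    vanish at [w]. *)
Definition infinite_sum (F : nat -> series Z) : series Z :=
  fun w => \sum_(k < (word_weight w).+1) F k w.

Section InfiniteSum.
Variable F : nat -> series Z.
Hypothesis FF : forall k, fil k (F k).

Lemma infinite_sum_approx n : fil n (infinite_sum F - \sum_(k < n) F k).
Proof.
move=> w wn; rewrite coefB coef_sum /infinite_sum; apply/eqP; rewrite subr_eq0.
apply/eqP/esym; rewrite -!(big_mkord xpredT (fun k => F k w)).
rewrite (big_cat_nat (leq0n _) wn) /= [X in _ + X]big_nat_cond.
by rewrite [X in _ + X]big1 ?addr0 // => k; rewrite andbT => /andP[/FF->].
Qed.

Lemma infinite_sum_unique f :
  (forall n, fil n (f - \sum_(k < n) F k)) -> infinite_sum F = f.
Proof.
move=> fF; apply/eqP; rewrite -subr_eq0; apply/eqP/fil_eq0 => n.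
have -> : infinite_sum F - f = (infinite_sum F - \sum_(k < n) F k) -
    (f - \sum_(k < n) F k) by rewrite opprB addrA subrK.
by apply: filB => //; exact: infinite_sum_approx.
Qed.

Lemma infinite_sum_recl :
  infinite_sum F = F 0%N + infinite_sum (fun k => F k.+1).
Proof.
apply: series_ext => w; rewrite coefD /infinite_sum big_ord_recl; congr (_ + _).
by rewrite [RHS]big_ord_recr /= [X in _ = _ + X]FF ?addr0 // ltnS.
Qed.

End InfiniteSum.

Lemma infinite_sumM g F : (forall k, fil k (F k)) ->
  g * infinite_sum F = infinite_sum (fun k => g * F k).
Proof.
move=> FF; apply/esym/infinite_sum_unique => [k|n].
  by rewrite -[k]add0n; apply: filM.
rewrite -mulr_sumr -mulrBr -[n]add0n; apply: filM => //.
exact: infinite_sum_approx.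
Qed.

Lemma infinite_sumD F G :
  infinite_sum (fun k => F k + G k) = infinite_sum F + infinite_sum G.
Proof. by apply: series_ext => w; rewrite coefD /infinite_sum -big_split. Qed.

Lemma infinite_sum_fil i F :
  (forall k, fil i (F k)) -> fil i (infinite_sum F).
Proof. by move=> Fi w wi; apply: big1 => k _; exact: Fi. Qed.

(* Geometric series; meaningful only when the constant coefficient of [f] is  *)
(* not zero.                                                                  *)
Definition series_inv f : series Z :=
  infinite_sum (fun k => (1 - scalar (f [::])^-1 * f) ^+ k) *
  scalar (f [::])^-1.

Lemma series_mulV f : f [::] != 0 -> f * series_inv f = 1.
Proof.
move=> f0; rewrite /series_inv; set c := f [::] in f0 *.
set h := 1 - _; set s := infinite_sum _.
have h1 : fil 1 h.
  move=> [|z w]; last by have /word_weight_gt0 : z :: w <> [::] by []; lia.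
  by rewrite /h coefB coef1 coef_scalarM mulVf ?subrr.
have hk k : fil k (h ^+ k) by rewrite -[k in fil k]muln1; exact: filX.
have sE : s = 1 + h * s.
  rewrite [s in LHS]infinite_sum_recl // expr0 infinite_sumM //; congr (_ + _).
  by congr infinite_sum; apply/funext => k; rewrite exprS.
have fE : f = scalar c * (1 - h).
  rewrite /h opprB addrCA subrr addr0 mulrA scalarM divff //.
  by rewrite -[scalar 1]/(1 : series Z) mul1r.
have hs : (1 - h) * s = 1 by rewrite mulrBl mul1r {1}sE addrK.
by rewrite fE !mulrA -(mulrA (scalar c)) hs mulr1 scalarM divff.
Qed.

(** * Division by a series with a chosen shortest word *)

Section Division.
Variables (t : series Z) (w : seq Z).
Hypothesis tw : t w != 0.
Hypothesis t_low : forall v, (size v < size w)%N -> t v = 0.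

(** Taking [lquot w] of f = t q + r kills r and leaves the equation lquot w f = lquot w t * q, whose
    factor [lquot w t] has the invertible constant term [t w]. *)
Definition quo f := series_inv (lquot w t) * lquot w f.
Definition rem f := f - t * quo f.

Lemma lquot_divisor_inv f : lquot w t * (series_inv (lquot w t) * f) = f.
Proof. by rewrite mulrA series_mulV ?mul1r // /lquot cats0. Qed.

Lemma quo_rem f : f = rem f + t * quo f. Proof. by rewrite subrK. Qed.

Lemma lquot_rem f : lquot w (rem f) = 0.
Proof. by rewrite lquotB lquotM_low // lquot_divisor_inv subrr. Qed.

Lemma rem_prefix f v : prefix w v -> rem f v = 0.
Proof. by move=> /prefixP[u ->]; rewrite -[LHS]/(lquot w _ u) lquot_rem coef0. Qed.

Lemma quo_unique q r : lquot w r = 0 -> quo (r + t * q) = q.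
Proof.
move=> r0; have t0 : lquot w t <> 0.
  by move=> /(congr1 (fun f => f [::])); rewrite coef0 /lquot cats0; apply/eqP.
apply: (series_mulfI t0).
by rewrite lquot_divisor_inv lquotD r0 add0r lquotM_low.
Qed.

Lemma rem_unique q r : lquot w r = 0 -> rem (r + t * q) = r.
Proof. by move=> r0; rewrite /rem quo_unique // addrK. Qed.

Lemma quoD f g : quo (f + g) = quo f + quo g.
Proof. by rewrite /quo lquotD mulrDr. Qed.

Lemma remD f g : rem (f + g) = rem f + rem g.
Proof. by rewrite /rem quoD mulrDr opprD addrACA. Qed.

Lemma quoM f : quo (t * f) = f.
Proof.
rewrite -[t * f]add0r quo_unique //.
by apply: series_ext => v; rewrite /lquot !coef0.
Qed.

Lemma remM f : rem (t * f) = 0.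
Proof. by rewrite /rem quoM subrr. Qed.

Hypothesis t_fil : fil (word_weight w) t.

Lemma quo_fil i f : fil i f -> fil (i - word_weight w) (quo f).
Proof.
move=> fi; rewrite -[(i - _)%N]add0n; apply: filM => // v vi.
by rewrite /lquot fi // word_weight_cat; lia.
Qed.

Lemma iter_quo_fil i k f :
  fil i f -> fil (i - k * word_weight w) (iter k quo f).
Proof.
move=> fi; elim: k => [|k IH]; first by rewrite mul0n subn0.
by rewrite iterS mulSn addnC subnDA; exact: quo_fil.
Qed.

Lemma rem_fil i f : fil i f -> fil i (rem f).
Proof.
move=> fi; apply: filB => //.
apply: (@fil_leq i (word_weight w + (i - word_weight w))); first by lia.
by apply: filM => //; exact: quo_fil.
Qed.

Hypothesis w0 : w <> [::].

(** Iterating the identity puts D f in t^n P for every n, hence in every level of the filtration. *)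
Lemma quo_vanish (C : set (series Z)) (D : series Z -> series Z) :
  (forall f, C f -> C (quo f)) -> (forall f, C f -> D f = t * D (quo f)) ->
  forall f, C f -> D f = 0.
Proof.
move=> Cq CD f Cf; apply: fil_eq0 => i; elim: i f Cf => [//|i IH] f Cf.
rewrite CD // -add1n; apply: filM; last exact/IH/Cq.
by apply: fil_leq t_fil; exact: word_weight_gt0.
Qed.

(** The coefficients r_k of the expansion of f as the sum of t^k r_k, where no word of r_k begins
    with [w]. *)
Definition coefs f k := rem (iter k quo f).

Definition support f : set (seq Z) := [set v | exists k, coefs f k v != 0].

Lemma support0 f : (forall v, ~ support f v) -> f = 0.
Proof.
apply: (@quo_vanish [set f | forall v, ~ support f v] id) => {}f sf.
  by move=> v [k kv]; apply: (sf v); exists k.+1; rewrite /coefs iterSr.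
rewrite {1}(quo_rem f) [rem f](_ : _ = 0) ?add0r //.
by apply: series_ext => v; rewrite coef0; apply/eqP; apply: contrapT => /negP h;
  apply: (sf v); exists 0%N.
Qed.

Lemma support_prefix f v : support f v -> ~~ prefix w v.
Proof.
by move=> [k]; apply: contraNN => wv; rewrite /coefs rem_prefix.
Qed.

(* Series with support in {1} are the power series in [t].                    *)
Lemma support_nil_comm f : support f `<=` [set [::]] -> f * t = t * f.
Proof.
move=> sf; apply/eqP; rewrite -subr_eq0; apply/eqP; move: f sf.
apply: (@quo_vanish [set f | support f `<=` [set [::]]]
  (fun f => f * t - t * f)) => f sf.
  by move=> v [k kv]; apply: (sf v); exists k.+1; rewrite /coefs iterSr.
have rE : rem f = scalar (rem f [::]).
  apply: series_ext => -[//|z v] /=; apply/eqP; apply: contrapT => /negP h.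
  by have /= : [set [::]] (z :: v) by apply: sf; exists 0%N.
rewrite {1 2}(quo_rem f) mulrDl mulrDr {1 2}rE scalar_comm.
by rewrite opprD addrACA subrr add0r -!mulrA mulrBr.
Qed.

End Division.
End Filtration.

(** * The Magnus representation *)

Section Magnus.
Variable Z : choiceType.
Implicit Types (z : Z) (b : bool) (v w : seq Z) (f : series Z).

Definition magnus_letter (a : letter Z) : series Z := fun w =>
  if a.2 then if all (pred1 a.1) w then (- 1) ^+ size w else 0
  else ((w == [::]) || (w == [:: a.1]))%:R.

Definition magnus_word (w : seq (letter Z)) : series Z :=
  foldr (fun a f => magnus_letter a * f) 1 w.

Lemma magnus_word_cons (a : letter Z) (w : seq (letter Z)) :
  magnus_word (a :: w) = magnus_letter a * magnus_word w.
Proof. by []. Qed.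

Definition magnus (g : free_group Z) : series Z := magnus_word (word g).

Lemma magnus_letter_nil a : magnus_letter a [::] = 1.
Proof. by case: a => z []. Qed.

Lemma lquot_magnus_letter z b y :
  lquot [:: y] (magnus_letter (z, b)) =
  if y == z then (if b then - magnus_letter (z, b) else 1) else 0.
Proof.
apply: series_ext => w; rewrite /lquot /magnus_letter /=.
have [->|/negPf yz] := eqVneq y z; case: b => /=.
- by rewrite coefN; case: ifP => _; rewrite ?oppr0 // exprS mulN1r.
- by rewrite eqseq_cons eqxx coef1; case: w.
- by rewrite ?yz coef0.
- by rewrite coef0 eqseq_cons yz.
Qed.

Lemma magnus_letterV z b :
  magnus_letter (z, b) * magnus_letter (z, ~~ b) = 1.
Proof.
have h : magnus_letter (z, false) * magnus_letter (z, true) = 1.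
  apply: series_ext => -[|y w]; first by rewrite coefM_nil !magnus_letter_nil.
  rewrite coefM_cons magnus_letter_nil lquot_magnus_letter mul1r coef1.
  rewrite -[X in X + _]/(lquot [:: y] (magnus_letter (z, true)) w).
  rewrite lquot_magnus_letter; case: eqP => _; last by rewrite mul0r !coef0.
  by rewrite mul1r coefN addNr.
case: b => //; have f0 : magnus_letter (z, false) <> 0.
  by move=> /(congr1 (fun f => f [::])); rewrite magnus_letter_nil.
by apply: (series_mulfI f0); rewrite mulrA h mul1r mulr1.
Qed.

Lemma magnus_push (a : letter Z) (w : seq (letter Z)) :
  magnus_word (push a w) = magnus_letter a * magnus_word w.
Proof.
case: w => [|c w] //=; case: eqP => [->|//].
by case: a => z b; rewrite mulrA magnus_letterV mul1r.
Qed.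

Lemma magnusM (g h : free_group Z) : magnus (g * h)%g = magnus g * magnus h.
Proof.
rewrite /magnus word_mulE; elim: (word g) => [|a v IH] /=.
  by rewrite mul1r.
by rewrite magnus_push IH mulrA.
Qed.

Let nonhead z (w : seq Z) := if w is y :: _ then y != z else true.
Let distinct_adj (w : seq Z) := sorted (fun y z => y != z) w.

Let magnus_letter_nonhead z b f w :
  nonhead z w -> (magnus_letter (z, b) * f) w = f w.
Proof.
case: w => [|y w] /=; first by rewrite coefM_nil magnus_letter_nil mul1r.
move=> /negPf yz; rewrite coefM_cons magnus_letter_nil mul1r.
by rewrite lquot_magnus_letter yz mul0r coef0 addr0.
Qed.

Let magnus_letter_head z b f w : nonhead z w ->
  (magnus_letter (z, b) * f) (z :: w) = f (z :: w) + (if b then - 1 else 1) * f w.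
Proof.
move=> zw; rewrite coefM_cons magnus_letter_nil mul1r lquot_magnus_letter eqxx.
congr (_ + _); case: b; last by rewrite !mul1r.
by rewrite mulN1r [_ * f]mulNr coefN magnus_letter_nonhead.
Qed.

(* [z :: s] is the word obtained from [w] by replacing each syllable          *)
(* [x ^ e] by [x]; its coefficient is the product of the exponents [e].       *)
Let magnus_syllables z b (w : seq (letter Z)) : reduced ((z, b) :: w) ->
  exists s n k, [/\ distinct_adj (z :: s), k != 0, (0 < n)%N,
    magnus_word ((z, b) :: w) (z :: s) = (if b then - 1 else 1) * n%:R * k &
    [/\ magnus_word ((z, b) :: w) s = k,
      forall v, distinct_adj v -> ((size s).+1 < size v)%N ->
        magnus_word ((z, b) :: w) v = 0 &
      forall v, distinct_adj v -> nonhead z v -> (size s < size v)%N ->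
        magnus_word ((z, b) :: w) v = 0]].
Proof.
have distinct_tl y v : distinct_adj (y :: v) -> nonhead y v /\ distinct_adj v.
  by case: v => //= x v /andP[]; rewrite eq_sym.
elim: w z b => [|[y c] w IH] z b.
  move=> _; exists [::], 1%N, 1.
  rewrite magnus_word_cons -[magnus_word [::]]/(1 : series Z); split=> //.
  - by rewrite magnus_letter_head // coef1 add0r !mulr1.
  split; [by rewrite magnus_letter_nonhead | move=> [|x v] // dv | move=> [|x v] // dv].
    have [xz sv|xz sv] := eqVneq x z; last by rewrite magnus_letter_nonhead.
    subst x; have [? _] := distinct_tl _ _ dv.
    rewrite magnus_letter_head // !coef1 add0r.
    by case: (v) sv => // x' v' _; rewrite mulr0.
  by move=> xz _; rewrite magnus_letter_nonhead.
move=> /andP[yz rw].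
have [s [n [k [ds k0 n0 hs1 [hs2 Z1 Z2]]]]] := IH y c rw.
have [sy dss] := distinct_tl _ _ ds.
have [yzE|yzN] := eqVneq y z.
  have bc : c = b.
    by move: yz; rewrite yzE /letter_inv /= xpair_eqE eqxx /=; case: (b) (c) => -[].
  subst y c; exists s, n.+1, k; rewrite magnus_word_cons; split=> //.
  - rewrite magnus_letter_head // hs1 hs2 -natr1; case: (b); ring.
  split; [by rewrite magnus_letter_nonhead | move=> [|x v] // dv | move=> v dv].
    have [xz|xz] := eqVneq x z => sv; last by rewrite magnus_letter_nonhead // Z1.
    subst x; have [zv dvv] := distinct_tl _ _ dv.
    by rewrite magnus_letter_head // Z1 // Z2 // mulr0 addr0.
  by move=> zv sv; rewrite magnus_letter_nonhead // Z2.
exists (y :: s), 1%N, ((if c then -1 else 1) * n%:R * k).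
rewrite magnus_word_cons; split=> //.
- by rewrite /= eq_sym yzN.
- by rewrite !mulf_neq0 // ?pnatr_eq0 -?lt0n //; case: (c); rewrite ?oppr_eq0 oner_eq0.
- rewrite magnus_letter_head // hs1 Z1 //=; last by rewrite eq_sym yzN.
  by rewrite mulr1 add0r.
split; [by rewrite magnus_letter_nonhead | move=> [|x v] // dv | move=> v dv].
  have [xz|xz] := eqVneq x z => sv; last first.
    by rewrite magnus_letter_nonhead // Z1 //; exact: ltnW.
  subst x; have [zv dvv] := distinct_tl _ _ dv.
  by rewrite magnus_letter_head // !Z1 // ?mulr0 ?addr0 //; exact: ltnW.
by move=> zv sv; rewrite magnus_letter_nonhead // Z1.
Qed.

Lemma magnus_eq1 (g : free_group Z) : magnus g = 1 -> g = 1%g.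
Proof.
move=> g1; apply: word_inj; move: g1 (word_reduced g); rewrite /magnus.
case: (word g) => // -[z b] w w1 /magnus_syllables[s [n [k [_ k0 n0 + _]]]].
rewrite w1 coef1 => /esym/eqP; rewrite !mulf_eq0 (negPf k0) orbF.
by rewrite pnatr_eq0 -[n == _]negbK -lt0n n0 orbF; case: (b).
Qed.

Lemma magnus_inj : injective magnus.
Proof.
move=> g h gh; apply: divg1_eq; apply: magnus_eq1.
by rewrite magnusM gh -magnusM mulgV.
Qed.

Lemma magnus_nil g : magnus g [::] = 1.
Proof.
rewrite /magnus; elim: (word g) => //= a w IH.
by rewrite coefM_nil magnus_letter_nil IH mulr1.
Qed.

End Magnus.

(** * Words and series in two colours *)

Section Colours.
Variables (Z : choiceType) (col : Z -> bool).
Implicit Types (s : bool) (v w : seq Z) (f g : series Z) (a : free_group Z).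

Definition monochrome s w := all (fun z => col z == s) w.

Definition mono_series s : set (series Z) :=
  [set f | forall w, f w != 0 -> monochrome s w].

Definition mono_group s a := all (fun l : letter Z => col l.1 == s) (word a).

Lemma mono_seriesB s f g :
  mono_series s f -> mono_series s g -> mono_series s (f - g).
Proof.
move=> fs gs w; apply: contraNT => ws; rewrite coefB.
rewrite (contraNeq (@fs w)) ?(contraNeq (@gs w)) ?subrr //.
Qed.

Lemma mono_seriesM s f g :
  mono_series s f -> mono_series s g -> mono_series s (f * g).
Proof.
move=> fs gs w /coefM_neq0[v1 [v2 [-> /fs h1 /gs h2]]].
by rewrite /monochrome all_cat; apply/andP.
Qed.

Lemma mono_series1 s : mono_series s 1.
Proof. by move=> [|z w] //; rewrite coef1 eqxx. Qed.

Lemma mono_magnus s a : mono_group s a -> mono_series s (magnus a).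
Proof.
rewrite /mono_group /magnus; elim: (word a) => [_|[z b] w IH /= /andP[zs ws]].
  exact: mono_series1.
apply: mono_seriesM (IH ws) => v; rewrite /magnus_letter /=; case: b.
  case: ifP => [vz _|_]; last by rewrite eqxx.
  by apply: sub_all vz => _ /eqP->.
case: v => //= y v; rewrite eqseq_cons /= pnatr_eq0 eqb0 negbK.
by case/andP=> /eqP-> /eqP->; rewrite zs.
Qed.

Lemma mono_groupM s a b :
  mono_group s a -> mono_group s b -> mono_group s (a * b)%g.
Proof.
rewrite /mono_group word_mulE; elim: (word a) => //= l v IH /andP[ls vs] bs.
have {}IH := IH vs bs; case: (foldr _ _ _) IH => [|l' v'] /=; first by rewrite ls.
by case/andP=> ls' vs'; case: ifP => //=; rewrite ls ls'.
Qed.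

Lemma mono_groupV s a : mono_group s a -> mono_group s a^-1%g.
Proof.
by rewrite /mono_group word_invE all_rev all_map; apply: sub_all.
Qed.

Lemma mono_group1 s : mono_group s 1%g. Proof. by []. Qed.

Lemma mono_groupX s a n : mono_group s a -> mono_group s (a ^+ n)%g.
Proof.
move=> sa; elim: n => [|n IH]; first exact: mono_group1.
by rewrite expgS; exact: mono_groupM.
Qed.

Lemma mono_group_cycle s a b :
  mono_group s a -> in_cycle a b -> mono_group s b.
Proof.
move=> sa [i [j ->]]; apply: mono_groupM; first exact: mono_groupX.
exact/mono_groupV/mono_groupX.
Qed.

(* The coefficient of [tau] in [f], seen as a series in the letters of colour *)
(* [s]; used when [tau] does not start with such a letter.                    *)
Definition slice s tau f : series Z :=
  fun w => if monochrome s w then f (w ++ tau) else 0.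

Definition starts_with s w := if w is z :: _ then col z == s else false.

(** Words of [p] have colour [s], so none of them, as a prefix of [w ++ tau], can reach into
    [tau]. *)
Lemma sliceM s tau p f : ~~ starts_with s tau -> mono_series s p ->
  slice s tau (p * f) = p * slice s tau f.
Proof.
move=> ts ps; apply: series_ext => w; rewrite {1}/slice.
case: ifPn => [ws|]; last first.
  apply: contraNeq; rewrite eq_sym => /coefM_neq0[v1 [v2 [-> /ps h1]]].
  rewrite /slice; case: ifP; rewrite ?eqxx // => h2 _.
  by rewrite /monochrome all_cat; apply/andP.
elim: w p ps ws => [|z w IH] p ps ws /=.
  rewrite coefM_nil /slice /=; case: tau ts => [_|y tau ys] /=.
    exact: coefM_nil.
  rewrite coefM_cons (_ : lquot [:: y] p = 0) ?mul0r ?coef0 ?addr0 //.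
  apply: series_ext => v; rewrite coef0; apply/eqP; apply: contraNT ys => h.
  by case/andP: (ps _ h).
rewrite !coefM_cons; congr (_ * _ + _); first by rewrite /slice ws.
case/andP: ws => _ ws; apply: IH => // v /ps.
by case/andP.
Qed.

Lemma sliceD s tau f g : slice s tau (f + g) = slice s tau f + slice s tau g.
Proof.
by apply: series_ext => w; rewrite coefD /slice; case: ifP; rewrite ?addr0.
Qed.

Section SliceDivision.
Variables (wt : Z -> nat) (s : bool) (t : series Z) (w tau : seq Z).
Hypothesis wt0 : forall z, (0 < wt z)%N.
Hypothesis tw : t w != 0.
Hypothesis t_low : forall v, (size v < size w)%N -> t v = 0.
Hypothesis ts : mono_series s t.
Hypothesis taus : ~~ starts_with s tau.

(** Slicing f = r + t q gives a division of the slice, because t has colour [s]; uniqueness of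
    division concludes. *)
Let slice_quo_rem f : quo wt t w (slice s tau f) = slice s tau (quo wt t w f) /\
  rem wt t w (slice s tau f) = slice s tau (rem wt t w f).
Proof.
have r0 : lquot w (slice s tau (rem wt t w f)) = 0.
  apply: series_ext => v; rewrite coef0 /lquot /slice; case: ifP => // _.
  by rewrite rem_prefix // -catA prefix_prefix.
by rewrite {1 3}(quo_rem wt t w f) sliceD sliceM // quo_unique // rem_unique.
Qed.

Lemma coefs_slice f k :
  coefs wt t w (slice s tau f) k = slice s tau (coefs wt t w f k).
Proof.
rewrite /coefs; have -> : iter k (quo wt t w) (slice s tau f) =
    slice s tau (iter k (quo wt t w) f).
  by elim: k => // k IH; rewrite !iterS IH; case: (slice_quo_rem (iter k (quo wt t w) f)).
by case: (slice_quo_rem (iter k (quo wt t w) f)).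
Qed.

Lemma support_slice f v : support wt t w (slice s tau f) v <->
  monochrome s v /\ support wt t w f (v ++ tau).
Proof.
split=> [[k]|[vs [k kv]]].
  rewrite coefs_slice /slice; case: ifP; rewrite ?eqxx // => vs kv.
  by split=> //; exists k.
by exists k; rewrite coefs_slice /slice vs.
Qed.

End SliceDivision.
End Colours.

(** * Exchanging two prefixes *)

Section Swap.
Variables (Z : eqType) (wt : Z -> nat) (w : bool -> seq Z).
Hypothesis w_disjoint : forall v, ~~ (prefix (w true) v && prefix (w false) v).
Hypothesis wtw : word_weight wt (w true) = word_weight wt (w false).

Definition swap v :=
  if prefix (w true) v then w false ++ drop (size (w true)) v
  else if prefix (w false) v then w true ++ drop (size (w false)) v
  else v.

Lemma swap_prefix s v : swap (w s ++ v) = w (~~ s) ++ v.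
Proof.
rewrite /swap; case: s => /=; first by rewrite prefix_prefix drop_size_cat.
have := w_disjoint (w false ++ v); rewrite prefix_prefix andbT => /negPf->.
by rewrite drop_size_cat.
Qed.

Lemma swap_id v :
  ~~ prefix (w true) v -> ~~ prefix (w false) v -> swap v = v.
Proof. by rewrite /swap => /negPf-> /negPf->. Qed.

Lemma swapP v : (exists s u, v = w s ++ u) \/
  ~~ prefix (w true) v /\ ~~ prefix (w false) v.
Proof.
have [/prefixP[u ->]|h1] := boolP (prefix (w true) v).
  by left; exists true, u.
have [/prefixP[u ->]|h2] := boolP (prefix (w false) v).
  by left; exists false, u.
by right.
Qed.

Lemma swapK : involutive swap.
Proof.
move=> v; case: (swapP v) => [[s [u ->]]|[h1 h2]].
  by rewrite !swap_prefix negbK.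
by rewrite !swap_id // swap_id.
Qed.

Lemma word_weight_swap v : word_weight wt (swap v) = word_weight wt v.
Proof.
case: (swapP v) => [[s [u ->]]|[h1 h2]]; last by rewrite swap_id.
by rewrite swap_prefix !word_weight_cat; case: s; rewrite /= wtw.
Qed.

End Swap.

(** * The representation of the amalgam *)

Definition series_filtration (Z : eqType) (wt : Z -> nat) : filtration (series Z) :=
  Filtration (@fil_zero Z wt) (@filD Z wt) (@filN Z wt)
    (fun i f => @fil_leq Z wt i i.+1 f (leqnSn i)) (@fil_isolated Z wt).

Section AmalgamRepresentation.
Variables (Z : choiceType) (col : Z -> bool).
Variables (c : bool -> free_group Z) (w : bool -> seq Z).
Let t s : series Z := magnus (c s) - 1.
Hypothesis c_mono : forall s, mono_group col s (c s).
Hypothesis c_npp : forall s, no_proper_power (c s).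
Hypothesis tw : forall s, t s (w s) != 0.
Hypothesis t_low : forall s v, (size v < size (w s))%N -> t s v = 0.
Implicit Types (s : bool) (v tau : seq Z) (f g p : series Z) (a : free_group Z).

(* With these weights both words [w true] and [w false] have the same weight. *)
Definition wt z := size (w (~~ col z)).

Lemma t_nil s : t s [::] = 0.
Proof. by rewrite /t coefB magnus_nil coef1 subrr. Qed.

Lemma w_neq0 s : w s <> [::].
Proof. by move=> w0; have := tw s; rewrite w0 t_nil eqxx. Qed.

Lemma wt_gt0 z : (0 < wt z)%N.
Proof. by rewrite /wt; have := @w_neq0 (~~ col z); case: (w _). Qed.

Lemma t_mono s : mono_series col s (t s).
Proof.
by apply: mono_seriesB; [exact: mono_magnus | exact: mono_series1].
Qed.

Lemma w_mono s : monochrome col s (w s). Proof. exact: t_mono. Qed.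

Lemma mono_weight s v :
  monochrome col s v -> word_weight wt v = (size v * size (w (~~ s)))%N.
Proof.
elim: v => //= z v IH /andP[/eqP zs /IH]; rewrite /word_weight /= => ->.
by rewrite mulSn /wt zs.
Qed.

Lemma wtw : word_weight wt (w true) = word_weight wt (w false).
Proof. by rewrite !(mono_weight (w_mono _)) mulnC. Qed.

(** On words of one colour weight is proportional to length, so a shortest word of [t s] is also a
    lightest one. *)
Lemma t_fil s : fil wt (word_weight wt (w s)) (t s).
Proof.
apply/filP => v tv.
rewrite (mono_weight (w_mono s)) (mono_weight (@t_mono s v tv)) leq_mul2r.
by rewrite leqNgt; apply/orP; right; apply: contraNN tv => /t_low->.
Qed.

Lemma t_fil1 s : fil wt 1 (t s).
Proof.
by apply: fil_leq (@t_fil s); apply: word_weight_gt0 (@w_neq0 s); exact: wt_gt0.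
Qed.

Lemma prefix_starts s v : prefix (w s) v -> starts_with col s v.
Proof.
have := @w_neq0 s; have := @w_mono s; case: (w s) => //= z u /andP[zs _] _.
by case: v => //= y v /andP[/eqP <-].
Qed.

Lemma starts_with_disjoint s v :
  starts_with col s v -> ~~ starts_with col (~~ s) v.
Proof. by case: v => //= z v /eqP->; case: s. Qed.

Lemma w_disjoint v : ~~ (prefix (w true) v && prefix (w false) v).
Proof.
apply/andP => -[/prefix_starts h1 /prefix_starts h2].
by have := starts_with_disjoint h1; rewrite h2.
Qed.

Local Notation quo_ s := (quo wt (t s) (w s)).
Local Notation rem_ s := (rem wt (t s) (w s)).
Local Notation coefs_ s := (coefs wt (t s) (w s)).
Local Notation supp s := (support wt (t s) (w s)).
Local Notation fil := (fil wt).

Definition theta f : series Z := fun v => f (swap w v).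

Lemma thetaK : involutive theta.
Proof.
by move=> f; apply: series_ext => v; rewrite /theta swapK //; exact: w_disjoint.
Qed.

Lemma lquot_theta s f : lquot (w s) f = 0 -> lquot (w (~~ s)) (theta f) = 0.
Proof.
move=> f0; apply: series_ext => v.
rewrite /lquot /theta swap_prefix ?negbK; last exact: w_disjoint.
by rewrite -[LHS]/(lquot (w s) f v) f0.
Qed.

Lemma theta_fil i f : fil i f -> fil i (theta f).
Proof.
move=> fi v vi; apply: fi; rewrite word_weight_swap //; last exact: wtw.
exact: w_disjoint.
Qed.

(* Identifies the two copies of the space of series in which the elements of  *)
(* colour [s], respectively [~~ s], act by left multiplication; multiplication*)
(* by [t s] becomes multiplication by [t (~~ s)].                             *)
Definition Xi s f : series Z :=
  infinite_sum wt (fun k => t (~~ s) ^+ k * theta (coefs_ s f k)).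

Lemma Xi_summable s f k : fil k (t (~~ s) ^+ k * theta (coefs_ s f k)).
Proof.
rewrite -[k in fil k]addn0; apply: filM => //; rewrite -[k in fil k]muln1.
by apply: filX; exact: t_fil1.
Qed.

Lemma Xi_recl s f : Xi s f = theta (rem_ s f) + t (~~ s) * Xi s (quo_ s f).
Proof.
rewrite {1}/Xi infinite_sum_recl; last exact: Xi_summable.
rewrite expr0 mul1r infinite_sumM; last exact: Xi_summable.
congr (_ + infinite_sum _ _); apply/funext => k.
by rewrite exprS mulrA /coefs iterSr.
Qed.

Lemma quo_Xi s f : quo_ (~~ s) (Xi s f) = Xi s (quo_ s f).
Proof.
rewrite Xi_recl quo_unique //; [exact: wt_gt0 | exact: t_low |].
by apply: lquot_theta; apply: lquot_rem => //; [exact: wt_gt0 | exact: t_low].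
Qed.

Lemma rem_Xi s f : rem_ (~~ s) (Xi s f) = theta (rem_ s f).
Proof.
rewrite Xi_recl rem_unique //; [exact: wt_gt0 | exact: t_low |].
by apply: lquot_theta; apply: lquot_rem => //; [exact: wt_gt0 | exact: t_low].
Qed.

Lemma coefs_Xi s f k : coefs_ (~~ s) (Xi s f) k = theta (coefs_ s f k).
Proof.
rewrite /coefs; have -> : iter k (quo_ (~~ s)) (Xi s f) = Xi s (iter k (quo_ s) f).
  by elim: k => // k IH; rewrite !iterS IH quo_Xi.
exact: rem_Xi.
Qed.

Lemma support_Xi s f v : supp (~~ s) (Xi s f) v <-> supp s f (swap w v).
Proof. by split=> -[k]; rewrite ?coefs_Xi => h; exists k; rewrite ?coefs_Xi. Qed.

Lemma XiK s : cancel (Xi s) (Xi (~~ s)).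
Proof.
move=> f; apply/eqP; rewrite -subr_eq0; apply/eqP; move: f (I : setT f).
(* For D f = Xi (Xi f) - f the remainders cancel, as [theta] is an involution, and D f = t * D (quo
   f) is left. *)
apply: (quo_vanish (wt := wt) wt_gt0 (t := t s) (w := w s) (@t_fil s) (@w_neq0 s)
  (D := fun f => Xi (~~ s) (Xi s f) - f)) => // f _.
rewrite Xi_recl rem_Xi thetaK quo_Xi negbK [X in _ - X = _](quo_rem wt (t s) (w s) f).
by rewrite opprD addrACA subrr add0r mulrBr.
Qed.

Lemma coefsD s f g k : coefs_ s (f + g) k = coefs_ s f k + coefs_ s g k.
Proof.
rewrite /coefs; have -> : iter k (quo_ s) (f + g) = iter k (quo_ s) f + iter k (quo_ s) g.
  by elim: k => // k IH; rewrite !iterS IH quoD.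
exact: remD.
Qed.

Lemma XiD s f g : Xi s (f + g) = Xi s f + Xi s g.
Proof.
rewrite /Xi -infinite_sumD; congr infinite_sum; apply/funext => k.
by rewrite coefsD -mulrDr.
Qed.

Lemma Xi_t s f : Xi s (t s * f) = t (~~ s) * Xi s f.
Proof.
have [h1 h2] := (wt_gt0, @t_low s).
rewrite Xi_recl remM // quoM //.
rewrite [theta 0](_ : _ = 0) ?add0r //.
by apply: series_ext => v; rewrite /theta !coef0.
Qed.

Lemma Xi_fil s i f : fil i f -> fil i (Xi s f).
Proof.
move=> fi; apply: infinite_sum_fil => k; set n := word_weight wt (w s).
have nE : word_weight wt (w (~~ s)) = n by rewrite /n; case: (s); rewrite wtw.
apply: (@fil_leq _ _ i (k * n + (i - k * n))); first by lia.
apply: filM; first by apply: filX; rewrite -nE; exact: t_fil.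
by apply/theta_fil/rem_fil/iter_quo_fil => //; exact: t_fil.
Qed.

Lemma quo_rem1 s : quo_ s 1 = 0 /\ rem_ s 1 = 1.
Proof.
have l1 : lquot (w s) 1 = 0.
  apply: series_ext => u; rewrite coef0 /lquot coef1.
  by have := @w_neq0 s; case: (w s).
have e1 : 1 = 1 + t s * 0 by rewrite mulr0 addr0.
have [h1 h2] := (wt_gt0, @t_low s).
by split; rewrite {1}e1 ?quo_unique ?rem_unique.
Qed.

Lemma coefs1_neq0 s v k : coefs_ s 1 k v != 0 -> v = [::].
Proof.
have [q1 r1] := quo_rem1 s; have [h1 h2] := (wt_gt0, @t_low s).
have q0 : quo_ s 0 = 0 by rewrite -{1}(mulr0 (t s)) quoM.
case: k => [|k]; rewrite /coefs.
  by rewrite r1 coef1; case: v => //; rewrite eqxx.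
rewrite iterSr q1; have -> : iter k (quo_ s) 0 = 0.
  by elim: k => // k IH; rewrite iterS IH.
by rewrite -{1}(mulr0 (t s)) remM // coef0 eqxx.
Qed.

Lemma support1 s v : supp s 1 v <-> v = [::].
Proof.
split=> [[k]|->]; first exact: coefs1_neq0.
apply: contrapT => h; suff /(congr1 (fun f => f [::])) : (1 : series Z) = 0 by [].
have [h1 h2] := (@t_fil s, @w_neq0 s).
apply: (support0 wt_gt0 h1 h2) => u [k] ku; apply: h.
by have u0 := coefs1_neq0 ku; rewrite -u0; exists k.
Qed.

Lemma Xi1 s : Xi s 1 = 1.
Proof.
have X0 : Xi s 0 = 0 by apply: (addrI (Xi s 0)); rewrite -XiD !addr0.
have [q1 r1] := quo_rem1 s; rewrite Xi_recl q1 r1 X0 mulr0 addr0.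
apply: series_ext => v; rewrite /theta !coef1.
have [[r [u ->]]|[h1 h2]] := swapP w v; last by rewrite swap_id.
rewrite swap_prefix; last exact: w_disjoint.
have := @w_neq0 r; have := @w_neq0 (~~ r).
by case: (w r) => //; case: (w (~~ r)).
Qed.

(** Series are stored in the coordinates of colour [true]; [view s] passes to those in which colour
    [s] acts by left multiplication. *)
Definition view s f := if s then f else Xi true f.
Definition unview s f := if s then f else Xi false f.

Lemma viewK s : cancel (view s) (unview s).
Proof. by case: s => f //; exact: (@XiK true). Qed.
Lemma unviewK s : cancel (unview s) (view s).
Proof. by case: s => f //; exact: (@XiK false). Qed.
Lemma view_negb s f : view (~~ s) f = Xi s (view s f).
Proof. by case: s => //=; rewrite (@XiK true). Qed.
Lemma viewD s f g : view s (f + g) = view s f + view s g.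
Proof. by case: s; rewrite //= XiD. Qed.
Lemma unviewD s f g : unview s (f + g) = unview s f + unview s g.
Proof. by case: s; rewrite //= XiD. Qed.
Lemma view_fil s i f : fil i f -> fil i (view s f).
Proof. by case: s => //; exact: Xi_fil. Qed.
Lemma unview_fil s i f : fil i f -> fil i (unview s f).
Proof. by case: s => //; exact: Xi_fil. Qed.
Lemma view1 s : view s 1 = 1. Proof. by case: s; rewrite //= Xi1. Qed.

Definition letter_act (l : letter Z) f :=
  unview (col l.1) (magnus_letter l * view (col l.1) f).

Lemma letter_actD l f g : letter_act l (f + g) = letter_act l f + letter_act l g.
Proof. by rewrite /letter_act viewD mulrDr unviewD. Qed.

Lemma letter_actK z b : cancel (letter_act (z, b)) (letter_act (z, ~~ b)).
Proof.
move=> f; rewrite /letter_act /= unviewK mulrA -{2}(negbK b).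
by rewrite magnus_letterV mul1r viewK.
Qed.

Lemma letter_act_raises l : raises (series_filtration wt) 1 (letter_act l).
Proof.
move=> i f fi; rewrite addn1 /letter_act.
have -> : magnus_letter l = 1 + (magnus_letter l - 1) by rewrite addrC subrK.
rewrite mulrDl mul1r unviewD viewK addrC addKr; apply: unview_fil.
rewrite -add1n; apply: filM; last exact: view_fil.
move=> [|z v]; first by rewrite coefB magnus_letter_nil coef1 subrr.
by have := wt_gt0 z; rewrite /word_weight /=; lia.
Qed.

Definition letter_aut z : filtered_aut (series_filtration wt) :=
  FilteredAut (letter_actD (z, false)) (@letter_actK z false)
    (@letter_actK z true) (@letter_act_raises (z, false))
    (@letter_act_raises (z, true)).

Definition rho := word_eval letter_aut.
HB.instance Definition _ := UMagmaMorphism.on rho.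

Lemma rho_mono s a f :
  mono_group col s a -> rho a f = unview s (magnus a * view s f).
Proof.
rewrite /rho /mono_group /word_eval /magnus.
elim: (word a) f => [|l v IH] f /=; first by rewrite big_nil mul1r viewK.
move=> /andP[ls vs]; rewrite big_cons.
have lE g : (if l.2 then ((letter_aut l.1)^-1)%g else letter_aut l.1) g =
    unview s (magnus_letter l * view s g).
  by rewrite -(eqP ls); case: (l) => z [].
have mulE (x y : filtered_aut (series_filtration wt)) g : (x * y)%g g = x (y g).
  by [].
by rewrite mulE lE IH // unviewK mulrA.
Qed.

(** Each [c s] acts as multiplication by 1 + t s in its own coordinates, and [Xi_t] matches these
    two actions. *)
Lemma rho_relation : rho (c true) = rho (c false).
Proof.
apply: faut_inj => f; rewrite (rho_mono _ (c_mono true)) (rho_mono _ (c_mono false)).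
have cE s : magnus (c s) = 1 + t s by rewrite /t addrC subrK.
rewrite !cE /= !(mulrDl 1) !mul1r XiD (@XiK true) (@Xi_t false).
by rewrite (@XiK true).
Qed.

(** * Block length and faithfulness *)

Inductive blocks : bool -> nat -> seq Z -> Prop :=
| BlocksNil s : blocks s 0 [::]
| BlocksCons s n v tau of v <> [::] & monochrome col s v & ~~ prefix (w s) v &
    blocks (~~ s) n tau : blocks s n.+1 (v ++ tau).

Lemma blocks_starts s n v : blocks s n v -> v <> [::] -> starts_with col s v.
Proof. by case=> // {}s {}n [|z {}v] tau //= _ /andP[]. Qed.

Lemma blocks_negb_starts s n v : blocks (~~ s) n v -> ~~ starts_with col s v.
Proof.
move=> /blocks_starts; case: v => // z v /(_ _)/starts_with_disjoint.
by rewrite negbK; apply.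
Qed.

Lemma mono_split s v : exists v1 tau,
  [/\ v = v1 ++ tau, monochrome col s v1 & ~~ starts_with col s tau].
Proof.
elim: v => [|z v [v1 [tau [-> v1s ts]]]]; first by exists [::], [::].
have [zs|zs] := boolP (col z == s); last by exists [::], (z :: v1 ++ tau).
by exists (z :: v1), tau; rewrite /= zs.
Qed.

Lemma mono_cat_inj s v1 v2 tau1 tau2 :
  monochrome col s v1 -> monochrome col s v2 ->
  ~~ starts_with col s tau1 -> ~~ starts_with col s tau2 ->
  v1 ++ tau1 = v2 ++ tau2 -> v1 = v2 /\ tau1 = tau2.
Proof.
elim: v1 v2 => [|z v1 IH] [|y v2] //=.
- by move=> _ /andP[ys _] + _ e; rewrite e /= ys.
- by move=> /andP[ys _] _ _ + e; rewrite -e /= ys.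
by move=> /andP[_ h1] /andP[_ h2] h3 h4 [-> /IH[]// -> ->].
Qed.

Lemma blocks_inv s n v : blocks s n v -> n = 0%N /\ v = [::] \/
  exists v1 tau m, [/\ v = v1 ++ tau, n = m.+1, v1 <> [::],
    monochrome col s v1 & blocks (~~ s) m tau].
Proof.
case=> [{}s|{}s m v1 tau v10 vs _ bl]; first by left.
by right; exists v1, tau, m.
Qed.

Lemma blocks_tail s s' n v tau :
  monochrome col s v -> ~~ starts_with col s tau -> blocks s' n (v ++ tau) ->
  exists2 m, blocks (~~ s) m tau & n = (m + (v != [::]))%N.
Proof.
move=> vs ts; case: (eqVneq s' (~~ s)) => [->|s's] bl.
  case: v vs bl => [|z v] /= vs bl; first by exists n; rewrite ?addn0.
  by have := blocks_negb_starts bl; case/andP: vs => /= ->.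
have {}s's : s' = s by move: s's; case: (s) (s') => -[].
subst s'; have [[-> E]|[v1 [tau1 [m [E -> v10 v1s bl']]]]] := blocks_inv bl.
  by case: v E {vs bl} => //= ->; exists 0%N => //; exact: BlocksNil.
have [vE tE] := mono_cat_inj vs v1s ts (blocks_negb_starts bl') E.
exists m; rewrite ?tE // vE; case: (v1) v10 => // *; exact/esym/addn1.
Qed.

Lemma blocks_unique s s' n m v : blocks s n v -> blocks s' m v -> n = m.
Proof.
elim: n s s' m v => [|n IH] s s' m v.
  move=> /blocks_inv[[_ ->]|[? [? [? []]]]] // /blocks_inv[[->]|] //.
  by move=> [[|z v1] [tau [k []]]].
move=> /blocks_inv[[]|[v1 [tau [k [-> [<-] v10 v1s bl]]]]] //.
move=> /(blocks_tail v1s (blocks_negb_starts bl))[k' bl' ->].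
by rewrite -(IH _ _ _ _ bl bl') -addn1; case: (v1) v10.
Qed.

(** A prefix [w r] has a single colour, so it would lie inside the first block. Consequently [swap]
    fixes such words and [Xi] preserves their membership in the support. *)
Lemma blocks_prefix s n v r : blocks s n v -> ~~ prefix (w r) v.
Proof.
case: n v / => [{}s|{}s n v tau v0 vs pv bl]; first by have := @w_neq0 r; case: (w r).
apply/negP => pr; have [rs|rs] := eqVneq r s; last first.
  have := prefix_starts pr; case: v v0 vs {pv pr} => //= z v _ /andP[/eqP-> _].
  by rewrite eq_sym (negPf rs).
subst r; case/prefixP: pr => u E; case/negP: pv.
have [u1 [u2 [uE u1s u2s]]] := mono_split s u.
rewrite uE catA in E.
have wu : monochrome col s (w s ++ u1).
  by rewrite /monochrome all_cat; apply/andP; split=> //; exact: w_mono.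
have [-> _] := mono_cat_inj vs wu (blocks_negb_starts bl) u2s E.
exact: prefix_prefix.
Qed.

(** The longest word is asked to start with colour [~~ s], so that a factor of colour [s] can put a
    new block in front of it. *)
Definition block_length s n f :=
  (forall v, supp s f v -> exists s' m, (m <= n)%N /\ blocks s' m v) /\
  exists2 v, supp s f v & blocks (~~ s) n v.

Lemma block_length1 s : block_length s 0 1.
Proof.
split=> [v /support1->|]; last first.
  by exists [::]; [exact/support1 | exact: BlocksNil].
by exists s, 0%N; split=> //; exact: BlocksNil.
Qed.

Lemma support_neq0 s f v : supp s f v -> f <> 0.
Proof.
move=> [k kv] f0; case/eqP: kv; have [h1 h2] := (wt_gt0, @t_low s).
have q0 : quo_ s 0 = 0 by rewrite -{1}(mulr0 (t s)) quoM.
have -> : coefs_ s f k = 0; last exact: coef0.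
rewrite f0 /coefs; have -> : iter k (quo_ s) 0 = 0.
  by elim: k => // k IH; rewrite iterS IH.
by rewrite -{1}(mulr0 (t s)) remM.
Qed.

(* If [f] and [magnus a * f] are power series in [t s], then [a] commutes     *)
(* with [c s].                                                                *)
Lemma support_outside_cycle s a f v : ~ in_cycle (c s) a ->
  supp s f v -> supp s f `<=` [set [::]] ->
  exists2 u, supp s (magnus a * f) u & u <> [::].
Proof.
move=> ca fv fs; apply: contrapT => h; apply: ca.
have {h} afs : supp s (magnus a * f) `<=` [set [::]].
  by move=> u hu; apply: contrapT => u0; apply: h; exists u.
have [h1 h2] := (@t_fil s, @w_neq0 s).
have tf := support_nil_comm wt_gt0 h1 h2 fs.
have taf := support_nil_comm wt_gt0 h1 h2 afs.
have f0 := support_neq0 fv.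
have ta : (magnus a * t s - t s * magnus a) * f = 0.
  by rewrite mulrBl -mulrA -tf mulrA taf mulrA subrr.
case: (series_mulf_eq0 ta) => // /eqP; rewrite subr_eq0 => /eqP {}ta.
apply: no_proper_power_centralizer => //; apply: magnus_inj.
rewrite !magnusM (_ : magnus (c s) = t s + 1); last by rewrite subrK.
by rewrite mulrDl mulrDr mul1r mulr1 ta.
Qed.

(** Multiplication by [magnus a] acts on each slice separately, changing only the initial block of
    colour [s]. On the slice at a word with n blocks it produces a nonempty initial block, because
    [a] is outside the cyclic group of [c s]. *)
Lemma block_length_step s n f a :
  mono_group col s a -> ~ in_cycle (c s) a -> block_length s n f ->
  block_length (~~ s) n.+1 (Xi s (magnus a * f)).
Proof.
move=> sa ca [fn [tau ftau btau]].
have [h1 h2] := (wt_gt0, @t_low s).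
have sm := mono_magnus sa.
have slM tau' v : ~~ starts_with col s tau' ->
    supp s (magnus a * slice col s tau' f) v <->
    monochrome col s v /\ supp s (magnus a * f) (v ++ tau').
  by move=> ts; rewrite -sliceM // support_slice //; exact: t_mono.
have sl tau' v : ~~ starts_with col s tau' ->
    supp s (slice col s tau' f) v <->
    monochrome col s v /\ supp s f (v ++ tau').
  by move=> ts; rewrite support_slice //; exact: t_mono.
have afn v : supp s (magnus a * f) v ->
    exists s' m, (m <= n.+1)%N /\ blocks s' m v.
  move=> av.
  have [v1 [tau1 [vE v1s ts1]]] := mono_split s v.
  have /support_neq0 af0 : supp s (magnus a * slice col s tau1 f) v1.
    by apply/slM => //; rewrite -vE.
  have [v2 v2P] : exists v2, supp s (slice col s tau1 f) v2.
    apply: contrapT => h; apply: af0.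
    rewrite (support0 h1 (@t_fil s) (@w_neq0 s) (f := slice col s tau1 f)).
      exact: mulr0.
    by move=> v2 hv2; apply: h; exists v2.
  move/(sl _ _ ts1): v2P => [v2s /fn[s' [m [mn bl]]]].
  have [m' bl' mE] := blocks_tail v2s ts1 bl.
  have [v10|v10] := eqVneq v1 [::].
    by exists (~~ s), m'; rewrite vE v10; split=> //; lia.
  exists s, m'.+1; split; first by lia.
  rewrite vE; apply: BlocksCons => //; first exact/eqP.
  have := support_prefix h1 (tw s) h2 av; apply: contra.
  by rewrite vE => /prefixP[u ->]; rewrite -catA prefix_prefix.
have fix_swap v : supp s (magnus a * f) v -> swap w v = v.
  by move=> /afn[s' [m [_ bl]]]; rewrite swap_id //; exact: blocks_prefix bl.
have swap_supp v : supp s (magnus a * f) (swap w v) -> swap w v = v.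
  move=> /fix_swap; rewrite swapK //; exact: w_disjoint.
split=> [v /support_Xi sv|].
  by move: (sv) => /swap_supp vE; move: sv; rewrite vE => /afn.
have ts := blocks_negb_starts btau.
(* The slice at [tau] contains only the empty word: a nonempty head before [tau] would make n+1
   blocks. Hence it is a nonzero power series in [t s]. *)
have ftau' : supp s (slice col s tau f) [::] by apply/sl.
have [|u uP u0] := support_outside_cycle ca ftau'.
  move=> v /(sl _ _ ts)[vs /fn[s' [m [mn /(blocks_tail vs ts)[m' bl' mE]]]]].
  move: mE mn; rewrite -(blocks_unique btau bl').
  by case: (eqVneq v [::]) => [->//|_] /= mE mn; lia.
move/(slM _ _ ts): uP => [us sut].
exists (u ++ tau); first by apply/support_Xi; rewrite fix_swap.
rewrite negbK; apply: BlocksCons => //.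
have := support_prefix h1 (tw s) h2 sut; apply: contra.
by move=> /prefixP[u' ->]; rewrite -catA prefix_prefix.
Qed.

Inductive alternating : bool -> free_group Z -> Prop :=
| Alternating1 s a of mono_group col s a & ~ in_cycle (c s) a : alternating s a
| AlternatingM s a b of mono_group col s a & ~ in_cycle (c s) a &
    alternating (~~ s) b : alternating s (a * b)%g.

Lemma alternating_block_length s a : alternating s a ->
  exists2 n, (0 < n)%N & block_length (~~ s) n (view (~~ s) (rho a 1)).
Proof.
elim=> {s a} [s a sa ca|s a g sa ca _ [n n0]].
  exists 1%N => //; rewrite (rho_mono _ sa) view_negb unviewK view1.
  by apply: block_length_step => //; exact: block_length1.
rewrite negbK => bl; exists n.+1 => //.
have -> : rho (a * g)%g 1 = rho a (rho g 1) by rewrite gmulfM.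
by rewrite (rho_mono _ sa) view_negb unviewK; exact: block_length_step.
Qed.

Lemma alternating_rho s a : alternating s a -> rho a 1 <> 1.
Proof.
move=> /alternating_block_length[n n0 [_ [v + bl]]] a1.
rewrite a1 view1 => /support1 v0; move: bl; rewrite v0 => /blocks_inv[[n0']|].
  by rewrite n0' in n0.
by move=> [[|z v1] [tau [m []]]].
Qed.

Lemma mono_rho s a : mono_group col s a -> a <> 1%g -> rho a 1 <> 1.
Proof.
move=> sa a1; rewrite (rho_mono _ sa) view1 => /(congr1 (view s)).
by rewrite unviewK mulr1 view1 => /magnus_eq1.
Qed.

End AmalgamRepresentation.

Local Close Scope ring_scope.
Local Open Scope group_scope.

(** * Normal forms in the amalgam *)

Lemma free_group_ind (X : choiceType) (P : free_group X -> Prop) :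
  P 1 -> (forall l g, P g -> P (@FreeGroup X [:: l] isT * g)) -> forall g, P g.
Proof.
move=> P1 PM g; have [n] := ubnP (size (word g)).
elim: n g => // n IH g; case E : (word g) => [|l v] gn.
  by have -> : g = 1 by apply: word_inj.
have gE : word g = word (@FreeGroup X [:: l] isT) ++ v by [].
rewrite -(mulVKg (@FreeGroup X [:: l] isT) g); apply: PM; apply: IH.
by rewrite (word_mul_size gE).
Qed.

Lemma word_eval_comp (X : choiceType) (G H : groupType)
    (f : UMagmaMorphism.type G H) (x : X -> G) g :
  f (word_eval x g) = word_eval (f \o x) g.
Proof.
rewrite /word_eval gmulf_prod; apply: eq_bigr => -[z b] _.
by case: b; rewrite //= gmulfV.
Qed.

Lemma word_eval_free_gen (X : choiceType) (g : free_group X) :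
  word_eval (@free_gen X) g = g.
Proof.
elim/free_group_ind: g => [|[z b] g IH]; first by rewrite gmulf1.
rewrite word_evalM IH; congr (_ * _); rewrite /word_eval big_seq1 /=.
by case: b => //; apply: word_inj.
Qed.

Section NormalForm.
Variables (Z : choiceType) (col : Z -> bool) (c : bool -> free_group Z).
Hypothesis c_mono : forall s, mono_group col s (c s).
Variables (H : groupType) (p : UMagmaMorphism.type (free_group Z) H).
Hypothesis pc : p (c true) = p (c false).
Implicit Types (s r : bool) (a b g : free_group Z).

Definition normal_form g :=
  in_cycle (c true) g \/ exists s, alternating col c s g.

Lemma cycle_transfer s r a : in_cycle (c s) a ->
  exists2 b, in_cycle (c r) b & p b = p a.
Proof.
move=> [i [j ->]]; exists (c r ^+ i * c r ^- j); first by exists i, j.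
rewrite !gmulfM !gmulfV !gmulfXn.
by have -> : p (c r) = p (c s) by case: (r) (s) => -[].
Qed.

Lemma cycle_mulr s a b :
  in_cycle (c s) a -> ~ in_cycle (c s) b -> ~ in_cycle (c s) (a * b).
Proof.
move=> ca cb cab; apply: cb; rewrite -(mulKg a b).
by apply: in_cycleM => //; exact: in_cycleV.
Qed.

Lemma cycle_mono s a : in_cycle (c s) a -> mono_group col s a.
Proof. exact: mono_group_cycle. Qed.

Lemma alternating_inv s g : alternating col c s g ->
  mono_group col s g /\ ~ in_cycle (c s) g \/
  exists a g', [/\ g = a * g', mono_group col s a, ~ in_cycle (c s) a &
                   alternating col c (~~ s) g'].
Proof. by case=> [{}s a sa ca|{}s a b sa ca alt]; [left | right; exists a, b]. Qed.

Lemma alternating_cycleM s a g : in_cycle (c s) a ->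
  alternating col c s g -> alternating col c s (a * g).
Proof.
move=> ca /alternating_inv[[sb cb]|[b [g' [-> sb cb alt]]]].
  apply: Alternating1; last exact: cycle_mulr.
  exact: mono_groupM (cycle_mono ca) sb.
rewrite mulgA; apply: AlternatingM => //; last exact: cycle_mulr.
exact: mono_groupM (cycle_mono ca) sb.
Qed.

Lemma cycle_normal_form s a : in_cycle (c s) a ->
  exists2 b, normal_form b & p b = p a.
Proof.
by move=> /(cycle_transfer true)[b cb pb]; exists b => //; left.
Qed.

(** When the leading factor falls into the amalgamated subgroup, [cycle_transfer] rewrites it in the
    other colour and the next factor absorbs it. *)
Lemma mono_mul_normal_form s a g : mono_group col s a -> normal_form g ->
  exists2 g', normal_form g' & p g' = p (a * g).
Proof.
move=> sa [cg|[r alt]].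
  have [b cb pb] := cycle_transfer s cg.
  have -> : p (a * g) = p (a * b) by rewrite !gmulfM pb.
  have sab : mono_group col s (a * b) := mono_groupM sa (cycle_mono cb).
  have [/cycle_normal_form//|cab] := pselect (in_cycle (c s) (a * b)).
  by exists (a * b) => //; right; exists s; exact: Alternating1.
have [rs|rs] := eqVneq r s.
  subst r; have [[sb cb]|[b [g' [-> sb cb alt']]]] := alternating_inv alt.
    have sab : mono_group col s (a * g) := mono_groupM sa sb.
    have [/cycle_normal_form//|cab] := pselect (in_cycle (c s) (a * g)).
    by exists (a * g) => //; right; exists s; exact: Alternating1.
  have sab : mono_group col s (a * b) := mono_groupM sa sb.
  rewrite mulgA; have [/(cycle_transfer (~~ s))[d cd pd]|cab] :=
    pselect (in_cycle (c s) (a * b)).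
    exists (d * g'); last by rewrite gmulfM pd -gmulfM.
    by right; exists (~~ s); exact: alternating_cycleM.
  by exists (a * b * g') => //; right; exists s; exact: AlternatingM.
have {rs} rs : r = ~~ s by case: (r) (s) rs => -[].
rewrite {}rs in alt.
have [/(cycle_transfer (~~ s))[d cd pd]|ca] := pselect (in_cycle (c s) a).
  exists (d * g); last by rewrite gmulfM pd -gmulfM.
  by right; exists (~~ s); exact: alternating_cycleM.
by exists (a * g) => //; right; exists s; exact: AlternatingM.
Qed.

Lemma normal_formP g : exists2 g', normal_form g' & p g' = p g.
Proof.
elim/free_group_ind: g => [|l g [g' nf pg]].
  by exists 1 => //; left; exact: in_cycle1.
rewrite gmulfM -pg -gmulfM; apply: (@mono_mul_normal_form (col l.1)) => //.
by rewrite /mono_group /= eqxx.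
Qed.

End NormalForm.

(** * Maps out of a presented group and the conclusion *)

Section PresentedGroup.
Variables (X : choiceType) (R : set (free_group X)) (H : groupType).
Variable f : UMagmaMorphism.type (free_group X) H.
Hypothesis fR : forall r, R r -> f r = 1.

Lemma normal_closure_kernel g : nset (normal_closure R) g -> f g = 1.
Proof.
move=> /(_ [set g | f g = 1]); apply; split=> //; split; first split.
- exact: gmulf1.
- by move=> x y /= fx fy; rewrite gmulfM fx fy mulg1.
- by move=> x /= fx; rewrite gmulfV fx invg1.
by move=> x y /= fx; rewrite gmulfJ fx conj1g.
Qed.

Lemma presented_group_lift :
  exists phi : UMagmaMorphism.type (presented_group R) H,
    forall g, phi (quot_proj _ g) = f g.
Proof.
pose phi (q : presented_group R) := f (repr q).
have phiE g : phi (quot_proj _ g) = f g.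
  apply: divg1_eq; rewrite /phi -gmulfF; apply: normal_closure_kernel.
  by apply/quot_proj_eq1; rewrite quot_projM quot_projK -quot_projM mulgV.
have phiM : (phi 1 = 1) * {morph phi : x y / x * y}.
  split=> [|x y]; first by rewrite -[1]/(quot_proj _ 1) phiE gmulf1.
  by rewrite -(quot_projK x) -(quot_projK y) -quot_projM !phiE gmulfM.
pose m := isUMagmaMorphism.Build (presented_group R) H phi phiM.
by exists (HB.pack_for (UMagmaMorphism.type (presented_group R) H) phi m).
Qed.

End PresentedGroup.

Theorem cyclic_amalgam_residually_torsion_free_nilpotent (m n : nat)
    (u : free_group 'I_m) (v : free_group 'I_n) :
  no_proper_power u -> no_proper_power v ->
  residually_torsion_free_nilpotent (amalgam u v).
Proof.
move=> hu hv.
pose Z : choiceType := ('I_m + 'I_n)%type.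
pose col (z : Z) := if z is inl _ then true else false.
pose x (i : 'I_m) : free_group Z := free_gen (inl i).
pose y (j : 'I_n) : free_group Z := free_gen (inr j).
pose c s := if s then word_eval x u else word_eval y v.
have c_mono s : mono_group col s (c s).
  have h (X : choiceType) (k : X -> free_group Z) (g : free_group X) :
      (forall i, mono_group col s (k i)) -> mono_group col s (word_eval k g).
    move=> hk; rewrite /word_eval; elim: (word g) => [|[i b] w IH].
      by rewrite big_nil; exact: mono_group1.
    rewrite big_cons; apply: mono_groupM => //=.
    by case: b; [apply: mono_groupV|].
  by rewrite /c; case: s h => h; apply: h.
have c_npp s : no_proper_power (c s).
  (* Killing one alphabet retracts the large free group onto the free group on the other, so being
     no proper power is inherited. *)
  pose r1 (z : Z) : free_group 'I_m := if z is inl i then free_gen i else 1.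
  pose r2 (z : Z) : free_group 'I_n := if z is inr j then free_gen j else 1.
  rewrite /c; case: s.
    apply: (no_proper_power_morph (f := word_eval r1)).
    rewrite word_eval_comp (_ : _ \o _ = @free_gen _) ?word_eval_free_gen //.
    by apply/funext => i; rewrite /= word_eval_gen.
  apply: (no_proper_power_morph (f := word_eval r2)).
  rewrite word_eval_comp (_ : _ \o _ = @free_gen _) ?word_eval_free_gen //.
  by apply/funext => i; rewrite /= word_eval_gen.
have /choice[w wP] s : exists w, (magnus (c s) - 1)%R w != 0%R /\
    forall v, (size v < size w)%N -> (magnus (c s) - 1)%R v = 0%R.
  have t0 : (magnus (c s) - 1 <> 0)%R.
    move=> /eqP; rewrite subr_eq0 => /eqP/magnus_eq1.
    exact: no_proper_power_neq1 (c_npp s).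
  by have [w w0 wl] := lowest_word t0; exists w.
have tw s := (wP s).1; have t_low s := (wP s).2.
pose f : UMagmaMorphism.type _ _ := rho c_mono tw t_low.
have fc : f (c true) = f (c false) by exact: rho_relation.
have fR r : [set c true * (c false)^-1] r -> f r = 1.
  by move=> ->; rewrite gmulfF fc mulgV.
have [phi phiE] := presented_group_lift fR.
move=> g g1.
have pc : quot_proj (normal_closure [set c true * (c false)^-1]) (c true) =
    quot_proj _ (c false).
  apply: divg1_eq; rewrite -gmulfF; apply/quot_proj_eq1.
  exact: sub_gen_smallest.
have [g' nf] := normal_formP c_mono pc (repr g).
rewrite /= quot_projK => gE.
have fg : f g' 1%R <> 1%R.
  case: nf => [cg|[s]]; last exact: alternating_rho.
  apply: (mono_rho (s := true)); first exact: mono_group_cycle cg.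
  by move=> g'1; apply: g1; rewrite -gE g'1.
have [z fz] : exists z, (f g' 1 - 1)%R z != 0%R.
  by apply: series_neq0 => /eqP; rewrite subr_eq0 => /eqP.
(* The displacement of the series 1, which has level 0, has a nonzero coefficient at the word [z];
   so it is not in the level just above the weight of [z]. *)
apply: (filtered_aut_residual (phi := phi) (n := word_weight (wt col w) z)).
rewrite -gE phiE => /(_ 0%N 1%R)/= h.
by case/eqP: fz; apply: h => //; rewrite add0n.
Qed.

Theorem theorem6 (m n : nat) (hm : (1 <= m)%N) (hn : (1 <= n)%N)
    (u : free_group 'I_m) (v : free_group 'I_n) :
  basic_commutator u -> basic_commutator v ->
  residually_torsion_free_nilpotent (amalgam u v).
Proof.
move=> /basic_commutator_no_proper_power hu /basic_commutator_no_proper_power hv.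
exact: cyclic_amalgam_residually_torsion_free_nilpotent.
Qed.
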